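(* Let $\mathcal G<E(d)$ be a discrete group in normal form, $x_0\in\mathbb R^d$ with $\mathcal G\cdot x_0\ne\{x_0\}$, $V$ an interaction potential with finite interaction range, $E$ its configurational energy, and $\mathcal R\subset\mathcal G$ an admissible neighborhood range of $id$. (i) Suppose that $\mathcal G$ is finite and $E'(\chi_{\mathcal G}x_0)=0$. Then $E''(\chi_{\mathcal G}x_0)$ is bounded with respect to $\|\cdot\|_{\mathcal R}=\|\cdot\|_{\mathcal R,0,0}$. In particular, $\lambda_{\mathrm a}=\lambda_{\mathrm a,0,0}\in\mathbb R$. (ii) Suppose that $\mathcal G$ is a space group. Then $E''(\chi_{\mathcal G}x_0)$ is bounded with respect to both $\|\cdot\|_{\mathcal R}$ and $\|\cdot\|_{\mathcal R,0,0}$. In particular, $\lambda_{\mathrm a},\lambda_{\mathrm a,0,0}\in\mathbb R$.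
   Context: Group setting. $\mathbb N=\{1,2,\dots\}$. $E(d)=O(d)\ltimes\mathbb R^d$ is the Euclidean group with product $(A_1,b_1)(A_2,b_2)=(A_1A_2,b_1+A_1b_2)$, acting on $\mathbb R^d$ by $(A,b)\cdot x=Ax+b$; $L((A,b))=A$, $\tau((A,b))=b$, and $id$ is the identity element. A subgroup of $E(d)$ is discrete if all its orbits in $\mathbb R^d$ are discrete. A $d_2$-dimensional space group is a discrete subgroup of $E(d_2)$ containing $d_2$ translations with linearly independent translation components. Normal form: $d=d_1+d_2$ with $d_1,d_2\in\mathbb N_0$, $\mathcal S$ is a $d_2$-dimensional space group, and $\mathcal G<E(d)$ is a discrete group all of whose elements are of the form $A\oplus s:=\left(\begin{pmatrix}A&0\\0&L(s)\end{pmatrix},\begin{pmatrix}0\\ \tau(s)\end{pmatrix}\right)$ with $A\in O(d_1)$, $s\in\mathcal S$, such that $\pi:\mathcal G\to\mathcal S$, $A\oplus s\mapsto s$, is surjective (every discrete group has this form up to conjugation in $E(d)$). ($\mathcal G$ is finite iff $d_1=d$, and a space group in $E(d)$ iff $d_1=0$.) $\mathcal T\subset\mathcal G$ is a fixed set mapped bijectively by $\pi$ onto the subgroup $\mathcal T_{\mathcal S}$ of translations of $\mathcal S$. For $N\in\mathbb N$, $\mathcal T^N:=\{t^N: t\in\mathcal T\}$, and $M_0:=\{N\in\mathbb N:\mathcal T^N\text{ is a normal subgroup of }\mathcal G\}$; it is known that $M_0=m_0\mathbb N$ for some $m_0\in\mathbb N$ and that $\mathcal T^N$ has finite index in $\mathcal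 G$ for $N\in M_0$. $\mathcal C_N$ is a fixed set of representatives of $\mathcal G/\mathcal T^N$. A function $u$ on $\mathcal G$ is $\mathcal T^N$-periodic if $u(gt)=u(g)$ for all $g\in\mathcal G,t\in\mathcal T^N$, and periodic if it is $\mathcal T^N$-periodic for some $N\in M_0$. $U_{\mathrm{per}}$ is the space of periodic functions $\mathcal G\to\mathbb R^d$. Structure. $x_0\in\mathbb R^d$, $\mathcal G_{x_0}$ is the (finite) stabilizer of $x_0$ in $\mathcal G$, $d_{\mathrm{aff}}$ is the dimension of the affine hull $\mathrm{aff}(\mathcal G\cdot x_0)$. Coordinates are normalized so that $\mathrm{aff}(\mathcal G\cdot x_0)=\{0_{d-d_{\mathrm{aff}}}\}\times\mathbb R^{d_{\mathrm{aff}}}$ and every $g\in\mathcal G$ acts trivially on the first $d-d_{\mathrm{aff}}$ coordinates. $\mathcal G_\sim:=\mathcal G/\mathcal G_{x_0}$ (left cosets), $\mathcal G_\sim^*:=\mathcal G_\sim\setminus\{\mathcal G_{x_0}\}$. For $\mathcal R\subset\mathcal G$ with $\mathcal R\mathcal G_{x_0}=\mathcal R$ and $u:\mathcal R\to\mathbb R^d$ put $\bar u(g):=\frac1{|\mathcal G_{x_0}|}\sum_{h'\in\mathcal G_{x_0}}L(h')u(gh')$. Seminorms. $\mathcal R\subset\mathcal G$ is an admissible neighborhood range of $id$ if $\mathcal R$ is finite, $\mathcal R\mathcal G_{x_0}=\mathcal R$ and there are $\mathcal R',\mathcal R''\subset\mathcal G$ with $\mathcal R'\mathcal R''\subset\mathcal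 R$, $id\in\mathcal R'\cap\mathcal R''$, $\mathcal R'$ generating $\mathcal G$, and $\mathrm{aff}(\mathcal R''\cdot x_0)=\mathrm{aff}(\mathcal G\cdot x_0)$. $\mathrm{Skew}(d)$ is the space of real skew-symmetric $d\times d$ matrices, $\mathrm{Skew}_{0,0}(d)$ the subspace of those whose entries outside the upper left $d_1\times d_1$ block vanish. $U_{\mathrm{iso}}(\mathcal R)$ is the space of $u:\mathcal R\to\mathbb R^d$ for which there are $a\in\mathbb R^d$, $S\in\mathrm{Skew}(d)$ with $L(g)\bar u(g)=a+S(g\cdot x_0-x_0)$ for all $g\in\mathcal R$; $U_{\mathrm{iso},0,0}(\mathcal R)$ is defined likewise with $S\in\mathrm{Skew}_{0,0}(d)$. With $\|v\|^2=\sum_{h\in\mathcal R}\|v(h)\|^2$ on $(\mathbb R^d)^{\mathcal R}$ and $\pi_U$ the orthogonal projection of $(\mathbb R^d)^{\mathcal R}$ with kernel $U$, for $\mathcal T^N$-periodic $u\in U_{\mathrm{per}}$: $\|u\|_{\mathcal R}^2=\frac1{|\mathcal C_N|}\sum_{g\in\mathcal C_N}\|\pi_{U_{\mathrm{iso}}(\mathcal R)}(u(g\,\cdot)|_{\mathcal R})\|^2$ and $\|u\|_{\mathcal R,0,0}^2=\frac1{|\mathcal C_N|}\sum_{g\in\mathcal C_N}\|\pi_{U_{\mathrm{iso},0,0}(\mathcal R)}(u(g\,\cdot)|_{\mathcal R})\|^2$. Energy. An interaction potential is a function $V:(\mathbb R^d)^{\mathcal G_\sim^*}\to\mathbb R$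 such that (H1) $V(Ry)=V(y)$ for all $R\in O(d)$ and all $y$; (H2) for every $y:\mathcal G_\sim^*\to\mathbb R^d$ the map $L^\infty(\mathcal G_\sim^*,\mathbb R^d)\to\mathbb R$, $z\mapsto V(y+z)$, is twice continuously Fréchet differentiable (sup norm), with derivatives denoted $V'(y),V''(y)$; (H3) with $(\partial_gV(y))_i=V'(y)(\delta_ge_i)$ (row vector) and $(\partial_g\partial_hV(y))_{ij}=V''(y)(\delta_ge_i,\delta_he_j)$, where $\delta_g$ is the indicator function of $\{g\}$ on $\mathcal G_\sim^*$, one has $\sum_g\|\partial_gV(y)\|<\infty$ and $\sum_{g,h}\|\partial_g\partial_hV(y)\|<\infty$. $V$ has finite interaction range if there is a finite $\tilde{\mathcal R}_V\subset\mathcal G_\sim^*$ with $V(y)=V(\chi_{\tilde{\mathcal R}_V}y)$ for all $y$ ($\chi$ = indicator function); then (H3) is automatic. The configurational energy $E:U_{\mathrm{per}}\to\mathbb R$ is $$E(w)=\frac1{|\mathcal C_N|}\sum_{g\in\mathcal C_N}V\Big(\Big(\tfrac1{|\mathcal G_{x_0}|}\sum_{h'\in h}(gh')\cdot w(gh')-\tfrac1{|\mathcal G_{x_0}|}\sum_{h'\in\mathcal G_{x_0}}(gh')\cdot w(gh')\Big)_{h\in\mathcal G_\sim^*}\Big)$$ for $\mathcal T^N$-periodic $w$; it is twice continuously Fréchet differentiable for $\|\cdot\|_\infty$. $\chi_{\mathcal G}x_0$ is the constant function with value $x_0$. Stability constants. $\lambda_{\mathrm a}:=\sup\{c\in\mathbb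 R: c\|u\|_{\mathcal R}^2\le E''(\chi_{\mathcal G}x_0)(u,u)\ \forall u\in U_{\mathrm{per}}\}$, and $\lambda_{\mathrm a,0,0}$ is defined likewise with $\|\cdot\|_{\mathcal R,0,0}$ ($\sup\emptyset=-\infty$). A bilinear form $B$ on a real vector space $W$ is bounded with respect to a seminorm $\|\cdot\|$ if there is $C>0$ with $|B(v,w)|\le C\|v\|\|w\|$ for all $v,w\in W$. *)

(* Defs.v *)
From HB Require Import structures.
From mathcomp Require Import all_boot all_order all_algebra finmap.
From mathcomp Require Import all_classical all_reals all_analysis.

Set Implicit Arguments.
Unset Strict Implicit.
Unset Printing Implicit Defensive.

Import Order.TTheory GRing.Theory Num.Theory.
Import numFieldNormedType.Exports.

Local Open Scope classical_set_scope.
Local Open Scope ring_scope.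

(* Cardinality of a finite set, as a real number; 0 for an infinite set. *)
Definition cardR {R : realType} {T : choiceType} (A : set T) : R :=
  (#|` fset_set A|)%:R.

(* Frobenius norm; on column or row vectors it is the Euclidean norm, whereas
   the library's norm on matrices is the maximum norm. *)
Definition enorm {R : realType} {m n : nat} (A : 'M[R]_(m, n)) : R :=
  Num.sqrt (\sum_i \sum_j A i j ^+ 2).

Definition aff {R : realType} {d : nat} (A : set 'cV[R]_d) : set 'cV[R]_d :=
  [set x | exists n (p : 'I_n -> 'cV[R]_d) (c : 'I_n -> R),
     [/\ forall i, A (p i), \sum_i c i = 1 & x = \sum_i c i *: p i]].

Definition orthogonal_mx {R : realType} {d : nat} (A : 'M[R]_d) : bool :=
  A^T *m A == 1%:M.

(* The pair (A, b) stands for the isometry x |-> A x + b. *)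
Record euclid (R : realType) (d : nat) := Euclid {
  isom_pair :> 'M[R]_d * 'cV[R]_d;
  isom_pairP : orthogonal_mx isom_pair.1 }.

HB.instance Definition _ R d := [isSub for @isom_pair R d].
HB.instance Definition _ R d := [Choice of euclid R d by <:].

Section EuclideanGroup.
Context {R : realType} {d : nat}.
Implicit Types g h k : euclid R d.

Definition lin g : 'M[R]_d := (isom_pair g).1.
Definition tra g : 'cV[R]_d := (isom_pair g).2.
Definition act g (x : 'cV[R]_d) : 'cV[R]_d := lin g *m x + tra g.

Fact one_isom_pairP : orthogonal_mx (1%:M : 'M[R]_d, 0 : 'cV[R]_d).1.
Proof. by rewrite /orthogonal_mx /= trmx1 mulmx1. Qed.

Fact mul_isom_pairP g h :
  orthogonal_mx (lin g *m lin h, tra g + lin g *m tra h).1.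
Proof.
rewrite /orthogonal_mx /= trmx_mul mulmxA -(mulmxA _ _ (lin g)).
by rewrite (eqP (isom_pairP g)) mulmx1 (eqP (isom_pairP h)).
Qed.

Fact inv_isom_pairP g : orthogonal_mx ((lin g)^T, - ((lin g)^T *m tra g)).1.
Proof. by rewrite /orthogonal_mx /= trmxK (mulmx1C (eqP (isom_pairP g))). Qed.

Definition euclid_one := Euclid one_isom_pairP.
Definition euclid_mul g h := Euclid (mul_isom_pairP g h).
Definition euclid_inv g := Euclid (inv_isom_pairP g).

Fact euclid_mulA : associative euclid_mul.
Proof.
move=> g h k; apply/val_inj.
by rewrite /= /lin /tra /= mulmxA mulmxDr addrA mulmxA.
Qed.

Fact euclid_mul1 : left_id euclid_one euclid_mul.
Proof.
by move=> g; apply/val_inj; rewrite /= /lin /tra /= !mul1mx add0r; case: (val g).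
Qed.

Fact euclid_mulr1 : right_id euclid_one euclid_mul.
Proof.
move=> g; apply/val_inj.
by rewrite /= /lin /tra /= mulmx1 mulmx0 addr0; case: (val g).
Qed.

Fact euclid_mulV : left_inverse euclid_one euclid_inv euclid_mul.
Proof.
move=> g; apply/val_inj.
by rewrite /= /lin /tra /= addNr (eqP (isom_pairP g)).
Qed.

Fact euclid_mulrV : right_inverse euclid_one euclid_inv euclid_mul.
Proof.
move=> g; apply/val_inj; have E := mulmx1C (eqP (isom_pairP g)).
by rewrite /= /lin /tra /= mulmxN mulmxA E mul1mx subrr.
Qed.

End EuclideanGroup.

HB.instance Definition _ R d := isGroup.Build (euclid R d) euclid_mulA
  euclid_mul1 euclid_mulr1 euclid_mulV euclid_mulrV.

(* A subgroup G is a [groupClosed] predicate; [elt G] is the type, again a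
   group, of its elements. *)
Definition elt {gT : groupType} (G : groupClosed gT) : Type :=
  {g : gT | g \in G}.

Section SubgroupType.
Variables (gT : groupType) (G : groupClosed gT).

Fact groupClosed_closed : group_closed G.
Proof. by split; [exact: gpred1 | exact: gpredF]. Qed.

HB.instance Definition _ := SubChoice.on (elt G).
HB.instance Definition _ :=
  SubChoice_isSubGroup.Build gT _ (elt G) groupClosed_closed.
End SubgroupType.

Section Groups.
Context {R : realType}.

Definition discrete_group {d} (G : groupClosed (euclid R d)) : Prop :=
  forall x : 'cV[R]_d, let orb := [set act g x | g in [set g | g \in G]] in
    forall y, orb y -> isolated orb y.

Definition space_group {d} (G : groupClosed (euclid R d)) : Prop :=
  discrete_group G /\
  exists t : 'I_d -> euclid R d,
    (forall i, t i \in G /\ lin (t i) = 1%:M) /\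
    row_free (\matrix_i (tra (t i))^T).

(* A (+) s, as a pair. *)
Definition oplus {d1 d2} (A : 'M[R]_d1) (s : euclid R d2) :
    'M[R]_(d1 + d2) * 'cV[R]_(d1 + d2) :=
  (block_mx A 0 0 (lin s), col_mx 0 (tra s)).

(* A (+) s |-> s; the default value 1 is only taken on isometries which are not
   of the form A (+) s. *)
Definition pi_S {d1 d2} (g : euclid R (d1 + d2)) : euclid R d2 :=
  insubd (1%g : euclid R d2) (drsubmx (lin g), dsubmx (tra g)).

Definition normal_form {d1 d2} (S : groupClosed (euclid R d2))
    (G : groupClosed (euclid R (d1 + d2))) : Prop :=
  [/\ space_group S, discrete_group G,
      forall g, g \in G -> exists A s,
        [/\ orthogonal_mx A, s \in S & isom_pair g = oplus A s]
    & pi_S @` [set g | g \in G] = [set s | s \in S]].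

Definition translations {d} (S : groupClosed (euclid R d)) :
    set (euclid R d) :=
  [set s | s \in S /\ lin s = 1%:M].

End Groups.

Definition normal_subgroup {gT : groupType} (H : set gT) : Prop :=
  group_closed [in H] /\ forall g h : gT, H h -> H (g * h * g^-1)%g.

Definition generates {gT : groupType} (A : set gT) : Prop :=
  forall H : set gT, group_closed [in H] -> A `<=` H -> H = setT.

Definition mul_set {gT : groupType} (A B : set gT) : set gT :=
  [set (a * b)%g | a in A & b in B].

Section Periodicity.
Context {gT : groupType}.
Implicit Types (T : set gT) (N : nat).

Definition pow_set T N : set gT := [set (t ^+ N)%g | t in T].

Definition M0 T : set nat := [set N | (0 < N)%N /\ normal_subgroup (pow_set T N)].

Definition representatives (C H : set gT) : Prop :=
  forall g, exists! c, C c /\ H (c^-1 * g)%g.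

Definition periodic_mod {W : Type} T N (u : gT -> W) : Prop :=
  forall g t, pow_set T N t -> u (g * t)%g = u g.

Definition Uper {W : Type} T : set (gT -> W) :=
  [set u | exists2 N, M0 T N & periodic_mod T N u].

(* Some N in M_0 such that u is T^N-periodic. The averages below do not depend
   on its choice. *)
Definition period {W : Type} T (u : gT -> W) : nat :=
  xget 1%N [set N | M0 T N /\ periodic_mod T N u].

(* Average over C_N of a T^N-periodic function on the group. *)
Definition cell_avg {R : realType} (C : nat -> set gT) N (f : gT -> R) : R :=
  (cardR (C N))^-1 * \sum_(g \in C N) f g.

End Periodicity.

(* Frechet differentiability at x, along a linear subspace U of X, with respect
   to a norm nrm on U. Derivatives are only meaningful on U; the operators D1
   and D2 return 0 if the derivative does not exist. *)
Section Frechet.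
Context {R : realType} {X : lmodType R}.
Variables (U : set X) (nrm : X -> R).
Implicit Types (f l : X -> R) (B : X -> X -> R) (x : X).

Definition bounded_linear l : Prop :=
  (forall a h k, U h -> U k -> l (a *: h + k) = a * l h + l k) /\
  exists C, forall h, U h -> `|l h| <= C * nrm h.

Definition bounded_bilinear B : Prop :=
  [/\ forall a h k v, U h -> U k -> U v ->
        B (a *: h + k) v = a * B h v + B k v,
      forall a h k v, U h -> U k -> U v ->
        B v (a *: h + k) = a * B v h + B v k
    & exists C, forall h k, U h -> U k -> `|B h k| <= C * nrm h * nrm k].

Definition is_D1 f x l : Prop :=
  bounded_linear l /\
  forall e, 0 < e -> exists2 r, 0 < r &
    forall h, U h -> nrm h < r -> `|f (x + h) - f x - l h| <= e * nrm h.

Definition D1 f x : X -> R := xget (fun=> 0) [set l | is_D1 f x l].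

(* The inequality for all h says that, in the operator norm,
   |D1 f (x + k) - D1 f x - B k| <= e |k|. *)
Definition is_D2 f x B : Prop :=
  [/\ bounded_bilinear B,
      is_D1 f x (D1 f x)
    & forall e, 0 < e -> exists2 r, 0 < r &
        forall k, U k -> nrm k < r ->
          is_D1 f (x + k) (D1 f (x + k)) /\
          forall h, U h ->
            `|D1 f (x + k) h - D1 f x h - B k h| <= e * nrm k * nrm h].

Definition D2 f x : X -> X -> R :=
  xget (fun=> fun=> 0) [set B | is_D2 f x B].

Definition frechet_C2 f : Prop :=
  forall x, U x ->
    is_D2 f x (D2 f x) /\
    forall e, 0 < e -> exists2 r, 0 < r &
      forall k, U k -> nrm k < r -> forall h v, U h -> U v ->
        `|D2 f (x + k) h v - D2 f x h v| <= e * nrm h * nrm v.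

End Frechet.

Section Potential.
Context {R : realType} {d : nat}.

Definition sup_norm {I : Type} (z : I -> 'cV[R]_d) : R :=
  sup [set enorm (z i) | i in setT].

Definition Linfty (I : Type) : set (I -> 'cV[R]_d) :=
  [set z | exists M, forall i, enorm (z i) <= M].

Context {I : choiceType}.
Implicit Types (V : (I -> 'cV[R]_d) -> R) (y : I -> 'cV[R]_d) (g h : I).

Definition V1 V y : (I -> 'cV[R]_d) -> R :=
  D1 (@Linfty I) sup_norm (fun z => V (y + z)) 0.

Definition V2 V y : (I -> 'cV[R]_d) -> (I -> 'cV[R]_d) -> R :=
  D2 (@Linfty I) sup_norm (fun z => V (y + z)) 0.

Definition delta_vec g (i : 'I_d) : I -> 'cV[R]_d :=
  fun h => if h == g then delta_mx i 0 else 0.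

Definition partial1 V y g : 'rV[R]_d := \row_i V1 V y (delta_vec g i).

Definition partial2 V y g h : 'M[R]_d :=
  \matrix_(i, j) V2 V y (delta_vec g i) (delta_vec h j).

Definition interaction_potential V : Prop :=
  [/\ forall A : 'M[R]_d, orthogonal_mx A ->
        forall y, V (fun g => A *m y g) = V y,
      forall y, frechet_C2 (@Linfty I) sup_norm (fun z => V (y + z))
    & forall y,
        (\esum_(g in [set: I]) (enorm (partial1 V y g))%:E < +oo)%E /\
        (\esum_(p in [set: I * I]) (enorm (partial2 V y p.1 p.2))%:E < +oo)%E].

Definition finite_range V : Prop :=
  exists2 A : set I, finite_set A & forall y, V y = V (patch (fun=> 0) A y).

End Potential.

Definition Skew {R : realType} {d} : set 'M[R]_d := [set S | S^T = - S].

Definition Skew00 {R : realType} {d1 d2} : set 'M[R]_(d1 + d2) :=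
  [set S | Skew S /\
     [/\ ursubmx S = 0, dlsubmx S = 0 & drsubmx S = 0]].

Section Model.
Context {R : realType} {d1 d2 : nat}.
Local Notation d := (d1 + d2)%N.
Variable G : groupClosed (euclid R d).
Variable x0 : 'cV[R]_d.
Implicit Types (g h : elt G) (T P : set (elt G)).
Implicit Types (C : nat -> set (elt G)) (u v w : elt G -> 'cV[R]_d).

Definition orbit_of P : set 'cV[R]_d := [set act (val g) x0 | g in P].

Definition stab : set (elt G) := [set g | act (val g) x0 = x0].

Definition cosets : set (set (elt G)) :=
  [set K | exists g, K = [set (g * h)%g | h in stab]].

Definition cosets_star : set (set (elt G)) := cosets `\ stab.

(* n is the dimension d_aff of the affine hull of the orbit; it is forced by the
   equality with a coordinate subspace. *)
Definition normalized_coords : Prop :=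
  exists n, [/\ (n <= d)%N,
    aff (orbit_of setT) =
      [set x | forall i : 'I_d, (i < d - n)%N -> x i 0 = 0]
  & forall g x (i : 'I_d), (i < d - n)%N -> act (val g) x i 0 = x i 0].

Definition bar u g : 'cV[R]_d :=
  (cardR stab)^-1 *: \sum_(k \in stab) (lin (val k) *m u (g * k)%g).

Definition admissible P : Prop :=
  [/\ finite_set P, mul_set P stab = P
    & exists P' P'' : set (elt G),
        [/\ mul_set P' P'' `<=` P, (P' `&` P'') 1%g, generates P'
          & aff (orbit_of P'') = aff (orbit_of setT)]].

(* The space of functions P -> R^d; such a function is represented by its
   extension by 0 to the group. *)
Definition funs_on P : set (elt G -> 'cV[R]_d) :=
  [set v | forall g, ~ P g -> v g = 0].

Definition dot P v w : R := \sum_(h \in P) ((v h)^T *m w h) 0 0.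

Definition orth_proj_ker P (W : set (elt G -> 'cV[R]_d)) v :
    elt G -> 'cV[R]_d :=
  xget (fun=> 0) [set p | [/\ funs_on P p, forall w, W w -> dot P p w = 0
                            & W (v - p)]].

(* U_iso(P) for Sk = Skew and U_(iso,0,0)(P) for Sk = Skew00. *)
Definition Uiso P (Sk : set 'M[R]_d) : set (elt G -> 'cV[R]_d) :=
  [set u | funs_on P u /\ exists a S, Sk S /\ forall g, P g ->
     lin (val g) *m bar u g = a + S *m (act (val g) x0 - x0)].

Definition seminorm T C P (Sk : set 'M[R]_d) u : R :=
  Num.sqrt (cell_avg C (period T u) (fun g =>
    let p := orth_proj_ker P (Uiso P Sk)
               (patch (fun=> 0) P (fun h => u (g * h)%g)) in
    dot P p p)).

Definition energy T C (V : (cosets_star -> 'cV[R]_d) -> R) w : R :=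
  cell_avg C (period T w) (fun g =>
    let mean (K : set (elt G)) : 'cV[R]_d := (cardR stab)^-1 *:
      \sum_(h \in K) act (val (g * h)%g) (w (g * h)%g) in
    V (fun K => mean (val K) - mean stab)).

Definition energy1 T C V : (elt G -> 'cV[R]_d) -> R :=
  D1 (Uper T) sup_norm (energy T C V) (fun=> x0).

Definition energy2 T C V :
    (elt G -> 'cV[R]_d) -> (elt G -> 'cV[R]_d) -> R :=
  D2 (Uper T) sup_norm (energy T C V) (fun=> x0).

Definition stability_constant T C V P (Sk : set 'M[R]_d) : \bar R :=
  ereal_sup [set c%:E | c in [set c : R | forall u, Uper T u ->
    c * seminorm T C P Sk u ^+ 2 <= energy2 T C V u u]].

End Model.

Arguments cosets_star {R d1 d2} G x0.
Arguments normalized_coords {R d1 d2} G x0.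
Arguments orbit_of {R d1 d2} G x0 P.

Definition bounded_wrt {R : realType} {X : Type} (W : set X) (nrm : X -> R)
    (B : X -> X -> R) : Prop :=
  exists2 c, 0 < c & forall v w, W v -> W w -> `|B v w| <= c * nrm v * nrm w.

(* Main.v *)
Require Import Defs.
From mathcomp Require Import all_boot all_order all_algebra finmap.
From mathcomp Require Import all_classical all_reals all_analysis.
From mathcomp Require Import ring lra.

Set Implicit Arguments.
Unset Strict Implicit.
Unset Printing Implicit Defensive.

Import Order.TTheory GRing.Theory Num.Theory.
Import numFieldNormedType.Exports.

Local Open Scope classical_set_scope.
Local Open Scope ring_scope.

(** Only means over G/T^N of functions of the symmetrized displacement [bar u]
   enter. On every patch gP, [rigid_approx] approximates it by an infinitesimal
   isometry (a_g, S_g) up to the local defect, whose mean is the squared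
   seminorm. Since P contains R'R'' with R' generating G and R''x_0 affinely
   spanning the orbit, neighbouring rigid motions agree on the directions of the
   orbit up to the defects, so that the approximation propagates to every finite
   patch, with constants independent of N.

   For a space group it remains to bound the mean of |S_g|^2. Differences of the
   displacement along lattice translations t_i satisfy a discrete Korn
   inequality, by summation by parts, and their symmetric parts do not see S_g.
   As the second derivative of the energy only involves finitely many
   differences of [bar u] on each patch, it is bounded. The seminorm with
   [Skew00] needs no separate argument, since everything holds for any linear
   space of skew matrices.

   For a finite group one single rigid motion approximates the displacement
   everywhere, so that it suffices that E''(x_0) vanishes on infinitesimal
   isometries in either argument. This follows by differentiating the invariance
   of E along the rotations given by the Cayley transform, since x_0 is
   critical.

   If the energy had no second derivative at x_0, [energy2] would be the default
   value 0 and the bounds would be trivial; otherwise its value is computed from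
   the uniqueness of directional derivatives. *)

(** * Euclidean geometry *)

Section InnerProduct.
Context {R : realType}.

(** A nonnegative binary quadratic form has nonpositive discriminant; this yields Cauchy-Schwarz
    both for vectors and for means. *)
Lemma discriminant_le (a b c : R) : 0 <= c ->
  (forall s t, 0 <= s ^+ 2 * a + 2 * (s * t) * b + t ^+ 2 * c) ->
  b ^+ 2 <= a * c.
Proof.
rewrite le_eqVlt => /predU1P[<- h|c0 h].
  (* For [c = 0] this choice of [s] and [t] gives the value [- b ^+ 2], so [b] vanishes. *)
  have := h b (- (a + 1) / 2); have := sqr_ge0 b; nra.
have := h c (- b) => {}h.
have : 0 <= c * (a * c - b ^+ 2) by apply: le_trans h _; nra.
by rewrite pmulr_rge0// subr_ge0.
Qed.

Definition ip {n} (u v : 'cV[R]_n) : R := (u^T *m v) 0 0.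
Local Notation nsq v := (ip v v).

Lemma ipE n (u v : 'cV[R]_n) : ip u v = \sum_i u i 0 * v i 0.
Proof. by rewrite /ip mxE; apply: eq_bigr => i _; rewrite mxE. Qed.

Lemma ipC n (u v : 'cV[R]_n) : ip u v = ip v u.
Proof. by rewrite !ipE; apply: eq_bigr => i _; rewrite mulrC. Qed.

Lemma ipDr n (u v w : 'cV[R]_n) : ip u (v + w) = ip u v + ip u w.
Proof. by rewrite /ip mulmxDr mxE. Qed.

Lemma ipDl n (u v w : 'cV[R]_n) : ip (v + w) u = ip v u + ip w u.
Proof. by rewrite ipC ipDr !(ipC u). Qed.

Lemma ipZr n a (u v : 'cV[R]_n) : ip u (a *: v) = a * ip u v.
Proof. by rewrite /ip -scalemxAr mxE. Qed.

Lemma ipZl n a (u v : 'cV[R]_n) : ip (a *: u) v = a * ip u v.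
Proof. by rewrite ipC ipZr ipC. Qed.

Lemma ipNr n (u v : 'cV[R]_n) : ip u (- v) = - ip u v.
Proof. by rewrite -scaleN1r ipZr mulN1r. Qed.

Lemma ipNl n (u v : 'cV[R]_n) : ip (- u) v = - ip u v.
Proof. by rewrite ipC ipNr ipC. Qed.

Lemma ip0r n (u : 'cV[R]_n) : ip u 0 = 0.
Proof. by rewrite /ip mulmx0 mxE. Qed.

Definition ip_linE := (ipDl, ipDr, ipNl, ipNr, ipZl, ipZr).

Lemma ip_mull m n (A : 'M[R]_(m, n)) u v : ip (A *m u) v = ip u (A^T *m v).
Proof. by rewrite /ip trmx_mul mulmxA. Qed.

Lemma nsqE n (v : 'cV[R]_n) : nsq v = \sum_i v i 0 ^+ 2.
Proof. by rewrite ipE; apply: eq_bigr => i _; rewrite expr2. Qed.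

Lemma nsq_ge0 n (v : 'cV[R]_n) : 0 <= nsq v.
Proof. by rewrite nsqE sumr_ge0// => i _; rewrite sqr_ge0. Qed.

Lemma nsq_entry n (v : 'cV[R]_n) i : v i 0 ^+ 2 <= nsq v.
Proof.
by rewrite nsqE (bigD1 i)//= lerDl sumr_ge0// => j _; rewrite sqr_ge0.
Qed.

Lemma nsq_eq0 n (v : 'cV[R]_n) : nsq v <= 0 -> v = 0.
Proof.
move=> v0; apply/matrixP => i j; rewrite ord1 mxE; apply/eqP.
by rewrite -sqrf_eq0 eq_le sqr_ge0 (le_trans (nsq_entry v i)).
Qed.

Lemma nsqD n (u v : 'cV[R]_n) : nsq (u + v) <= 2 * (nsq u + nsq v).
Proof. by have := nsq_ge0 (u - v); rewrite !ip_linE (ipC v u); lra. Qed.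

Lemma nsq_sub n (u v : 'cV[R]_n) : nsq (u - v) = nsq u - 2 * ip u v + nsq v.
Proof. by rewrite !ip_linE (ipC v u); ring. Qed.

Lemma nsqN n (u : 'cV[R]_n) : nsq (- u) = nsq u.
Proof. by rewrite !ip_linE opprK. Qed.

Lemma nsqB n (u v : 'cV[R]_n) : nsq (u - v) <= 2 * (nsq u + nsq v).
Proof. by rewrite (le_trans (nsqD _ _))// nsqN. Qed.

Lemma nsq_orth n (A : 'M[R]_n) v : orthogonal_mx A -> nsq (A *m v) = nsq v.
Proof. by move=> /eqP AA; rewrite ip_mull mulmxA AA mul1mx. Qed.

Lemma ip_CS n (u v : 'cV[R]_n) : ip u v ^+ 2 <= nsq u * nsq v.
Proof.
apply: discriminant_le; first exact: nsq_ge0.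
move=> s t; have := nsq_ge0 (s *: u + t *: v).
by rewrite !ip_linE (ipC v u) => /le_trans; apply; rewrite le_eqVlt; apply/orP; left; apply/eqP; ring.
Qed.

Lemma nsq_mul m n (A : 'M[R]_(m, n)) v :
  nsq (A *m v) <= (\sum_i \sum_j A i j ^+ 2) * nsq v.
Proof.
rewrite nsqE mulr_suml ler_sum// => i _.
have -> : (A *m v) i 0 = ip (row i A)^T v.
  by rewrite ipE mxE; apply: eq_bigr => j _; rewrite !mxE.
rewrite (le_trans (ip_CS _ _))// (nsqE (row i A)^T).
by under eq_bigr do rewrite !mxE.
Qed.

(** Convexity of the squared norm: with [y] the average, [ip y (x i) <= (nsq y + nsq (x i)) / 2],
    and averaging the left side gives back [nsq y]. *)
Lemma nsq_avg n (I : eqType) (s : seq I) (x : I -> 'cV[R]_n) B :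
  (0 < size s)%N -> (forall i, i \in s -> nsq (x i) <= B) ->
  nsq ((size s)%:R^-1 *: \sum_(i <- s) x i) <= B.
Proof.
move=> s0 xB; set y := _ *: _.
have m0 : 0 < (size s)%:R :> R by rewrite ltr0n.
have e : \sum_(i <- s) x i = (size s)%:R *: y.
  by rewrite scalerA divff ?scale1r// gt_eqF.
have ey : (size s)%:R * nsq y = \sum_(i <- s) ip y (x i).
  rewrite -ipZr -e; elim: (s) => [|i t IH]; first by rewrite !big_nil ip0r.
  by rewrite !big_cons ipDr IH.
have : \sum_(i <- s) ip y (x i) <= \sum_(i <- s) (nsq y + B) / 2.
  rewrite big_seq [leRHS]big_seq ler_sum// => i /xB.
  by have := nsq_ge0 (y - x i); rewrite nsq_sub; lra.
rewrite -ey big_const_seq count_predT iter_addr addr0 -[leRHS]mulr_natl.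
by rewrite ler_pM2l//; lra.
Qed.

Lemma enormE n (v : 'cV[R]_n) : enorm v = Num.sqrt (nsq v).
Proof.
by rewrite /enorm nsqE; congr Num.sqrt; apply: eq_bigr => i _; rewrite big_ord1.
Qed.

Lemma enorm_ge0 m n (v : 'M[R]_(m, n)) : 0 <= enorm v.
Proof. exact: sqrtr_ge0. Qed.

Lemma sqr_enorm n (v : 'cV[R]_n) : enorm v ^+ 2 = nsq v.
Proof. by rewrite enormE sqr_sqrtr// nsq_ge0. Qed.

Lemma enormZ n a (v : 'cV[R]_n) : enorm (a *: v) = `|a| * enorm v.
Proof.
by rewrite !enormE !ip_linE mulrA -expr2 sqrtrM ?sqr_ge0// sqrtr_sqr.
Qed.

Lemma enormD n (u v : 'cV[R]_n) : enorm (u + v) <= enorm u + enorm v.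
Proof.
rewrite -ler_sqr ?nnegrE ?addr_ge0 ?enorm_ge0//.
rewrite sqrrD !sqr_enorm !ip_linE (ipC v u).
have h : ip u v <= enorm u * enorm v.
  rewrite (le_trans (ler_norm _))// -ler_sqr ?nnegrE ?mulr_ge0 ?enorm_ge0//.
  by rewrite real_normK ?num_real// exprMn !sqr_enorm ip_CS.
by rewrite -mulr_natr; lra.
Qed.

Lemma enorm_mul m n (A : 'M[R]_(m, n)) (v : 'cV_n) : enorm (A *m v) <= enorm A * enorm v.
Proof.
rewrite -ler_sqr ?nnegrE ?mulr_ge0 ?enorm_ge0// exprMn !sqr_enorm.
rewrite (le_trans (nsq_mul _ _))// ler_wpM2r ?nsq_ge0//.
by rewrite sqr_sqrtr// sumr_ge0// => i _; rewrite sumr_ge0// => j _; rewrite sqr_ge0.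
Qed.

Lemma enorm_orth n (A : 'M[R]_n) (v : 'cV_n) : orthogonal_mx A -> enorm (A *m v) = enorm v.
Proof. by move=> oA; rewrite !enormE nsq_orth. Qed.

Lemma entry_enorm n (v : 'cV[R]_n) i : `|v i 0| <= enorm v.
Proof.
rewrite -ler_sqr ?nnegrE ?enorm_ge0// real_normK ?num_real// sqr_enorm.
exact: nsq_entry.
Qed.

Lemma skew_ip n (S : 'M[R]_n) v : Skew S -> ip v (S *m v) = 0.
Proof.
move=> /= SS; have : ip v (S *m v) = - ip v (S *m v).
  by rewrite {1}ipC ip_mull SS mulNmx ipNr.
by lra.
Qed.

End InnerProduct.
Notation nsq v := (ip v v).

(** * Means over a finite quotient *)

Section CellAverage.
Context {R : realType} {gT : groupType}.
Implicit Types (C H : set gT) (f : gT -> R).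

Definition hperiodic {W : Type} H (f : gT -> W) := forall g t, H t -> f (g * t)%g = f g.

Definition cell C H := [/\ normal_subgroup H, representatives C H & finite_set C].

Definition avg C f : R := (cardR C)^-1 * \sum_(g \in C) f g.

Lemma cardR_gt0 (T : choiceType) (A : set T) : finite_set A -> A !=set0 ->
  0 < cardR A :> R.
Proof.
move=> fA [x Ax]; rewrite /cardR ltr0n cardfs_gt0.
by apply/fset0Pn; exists x; rewrite in_fset_set// inE.
Qed.

Lemma fsum_fset (T : choiceType) (V : nmodType) (A : set T) (f : T -> V) :
  finite_set A -> \sum_(x \in A) f x = \sum_(x <- fset_set A) f x.
Proof. exact: fsbig_finite. Qed.

Section Cell.
Variables (C H : set gT).
Hypothesis cellC : cell C H.
Let nH : normal_subgroup H. Proof. by case: cellC. Qed.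
Let rC : representatives C H. Proof. by case: cellC. Qed.
Let fC : finite_set C. Proof. by case: cellC. Qed.

Lemma normal_mul x y : H x -> H y -> H (x * y)%g.
Proof.
by case: nH => -[H1 HB] _ /mem_set Hx /mem_set Hy; apply/set_mem;
  apply: (group_closedM (conj H1 HB)).
Qed.

Lemma normal_inv x : H x -> H x^-1%g.
Proof.
by case: nH => -[H1 HB] _ /mem_set Hx; apply/set_mem;
  apply: (group_closedV (conj H1 HB)).
Qed.

Lemma normal_conj x g : H x -> H (g^-1 * x * g)%g.
Proof. by case: nH => _ nn Hx; have := nn g^-1%g _ Hx; rewrite invgK. Qed.

Lemma cell_neq0 : C !=set0.
Proof. by have [c [[Cc _] _]] := rC 1%g; exists c. Qed.

Lemma cell_card_gt0 : 0 < cardR C :> R.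
Proof. exact: cardR_gt0 fC cell_neq0. Qed.

(** A bijection [p] that respects the coset relation permutes the cosets of [H]. Following it by the
    choice [r] of representatives gives a permutation of [C], and the periodic [f] does not see
    [r]. *)
Lemma cell_reindex (V : nmodType) (f : gT -> V) (p q : gT -> gT) :
  hperiodic H f -> cancel q p ->
  (forall x y, H ((p x)^-1 * p y)%g <-> H (x^-1 * y)%g) ->
  \sum_(g \in C) f (p g) = \sum_(g \in C) f g.
Proof.
move=> fH qK hp.
have [r rP] : {r : gT -> gT & forall g, C (r g) /\ H ((r g)^-1 * g)%g}.
  by apply: (@choice _ _ (fun g c => C c /\ H (c^-1 * g)%g)) => g; have [c [? _]] := rC g; exists c.
have uniqC x y : C x -> C y -> H (x^-1 * y)%g -> x = y.
  move=> Cx Cy Hxy; have [c [_ cu]] := rC y.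
  rewrite -(cu x)// (cu y)//; split=> //; rewrite mulVg.
  by case: nH => -[+ _] _; rewrite inE.
have fr g : f (r g) = f g.
  by rewrite -[in RHS](mulVKg (r g) g) fH//; case: (rP g).
rewrite [RHS](@reindex_fsbig _ _ _ _ _ (fun g => r (p g)) C C); last first.
  split.
  - by move=> g _ /=; case: (rP (p g)).
  - move=> x y /set_mem Cx /set_mem Cy rxy; apply: uniqC => //; apply/hp.
    have [_ hx] := rP (p x); have [_ hy] := rP (p y).
    have := normal_mul (normal_inv hx) hy.
    by rewrite rxy invgM invgK -mulgA mulVKg.
  - move=> c Cc; exists (r (q c)); first by case: (rP (q c)).
    apply: uniqC => //; first by case: (rP (p (r (q c)))).
    have [_ h1] := rP (p (r (q c))); have [_ /hp] := rP (q c); rewrite qK => h2.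
    by have := normal_mul h1 h2; rewrite -mulgA mulVKg.
by apply: eq_fsbigr => g _; rewrite fr.
Qed.

Lemma sum_right (V : nmodType) (f : gT -> V) h : hperiodic H f ->
  \sum_(g \in C) f (g * h)%g = \sum_(g \in C) f g.
Proof.
move=> fH; apply: (cell_reindex (p := fun g => (g * h)%g) (q := fun g => (g * h^-1)%g)) => //.
  by move=> g; rewrite mulgVK.
move=> x y; have e : ((x * h)^-1 * (y * h) = h^-1 * (x^-1 * y) * h)%g.
  by rewrite invgM !mulgA.
split=> [|/normal_conj]; last by rewrite e.
by rewrite e => /(normal_conj h^-1%g); rewrite invgK !mulgA mulgK mulgV mul1g.
Qed.

Lemma sum_left (V : nmodType) (f : gT -> V) h : hperiodic H f ->
  \sum_(g \in C) f (h * g)%g = \sum_(g \in C) f g.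
Proof.
move=> fH; apply: (cell_reindex (p := fun g => (h * g)%g) (q := fun g => (h^-1 * g)%g)) => //.
  by move=> g; rewrite mulVKg.
by move=> x y; rewrite invgM -mulgA mulKg.
Qed.

Lemma avg_right f h : hperiodic H f -> avg C (fun g => f (g * h)%g) = avg C f.
Proof. by move=> fH; rewrite /avg sum_right. Qed.

Lemma avg_left f h : hperiodic H f -> avg C (fun g => f (h * g)%g) = avg C f.
Proof. by move=> fH; rewrite /avg sum_left. Qed.

Lemma avgD f f' : avg C (fun g => f g + f' g) = avg C f + avg C f'.
Proof. by rewrite /avg -mulrDr !fsum_fset// big_split/=. Qed.

Lemma avgZ a f : avg C (fun g => a * f g) = a * avg C f.
Proof.
rewrite /avg !fsum_fset// mulrCA; congr (_ * _).
by rewrite mulr_sumr.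
Qed.

Lemma avg_sum (I : Type) (r : seq I) (Q : pred I) (F : I -> gT -> R) :
  avg C (fun g => \sum_(i <- r | Q i) F i g) = \sum_(i <- r | Q i) avg C (F i).
Proof.
by rewrite /avg -mulr_sumr fsum_fset// exchange_big/=; congr (_ * _);
  apply: eq_bigr => i _; rewrite fsum_fset.
Qed.

Lemma le_avg f f' : (forall g, f g <= f' g) -> avg C f <= avg C f'.
Proof.
move=> ff; rewrite /avg !fsum_fset// ler_wpM2l ?ler_sum//.
by rewrite invr_ge0 ltW// cell_card_gt0.
Qed.

Lemma avg_cst a : avg C (fun=> a) = a.
Proof.
rewrite /avg fsum_fset// big_const_seq count_predT iter_addr addr0.
by rewrite -[a *+ _]mulr_natl mulKf// gt_eqF// cell_card_gt0.
Qed.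

Lemma avg_ge0 f : (forall g, 0 <= f g) -> 0 <= avg C f.
Proof. by move=> f0; rewrite -[leLHS](avg_cst 0) le_avg. Qed.

Lemma avg_abs f : `|avg C f| <= avg C (fun g => `|f g|).
Proof.
rewrite ler_norml -mulN1r -avgZ; apply/andP; split; apply: le_avg => g.
  by rewrite mulN1r lerNl ler_normr lexx orbT.
exact: ler_norm.
Qed.

(** Turns a bound on a mean into a pointwise bound. The factor [cardR C] does no harm when the cell
    is fixed, as for a finite group, or when the mean vanishes. *)
Lemma le_term_avg f g : hperiodic H f -> (forall g, 0 <= f g) ->
  f g <= cardR C * avg C f.
Proof.
move=> fH f0; rewrite /avg mulVKf ?gt_eqF ?cell_card_gt0//.
have [c [[Cc Hc] _]] := rC g.
have -> : f g = f c by rewrite -(fH c _ Hc) mulVKg.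
rewrite fsum_fset// (big_fsetD1 c)/= ?in_fset_set ?inE// lerDl.
by rewrite sumr_ge0.
Qed.

Lemma avg_CS f f' : avg C (fun g => f g * f' g) ^+ 2 <=
  avg C (fun g => f g ^+ 2) * avg C (fun g => f' g ^+ 2).
Proof.
apply: discriminant_le; first by apply: avg_ge0 => g; rewrite sqr_ge0.
move=> s t; rewrite -!avgZ -!avgD; apply: avg_ge0 => g.
by have := sqr_ge0 (s * f g + t * f' g); nra.
Qed.

End Cell.

(* Summing f over products c * k, with c and k running through the two cells,
   evaluates both averages. *)
Lemma avg_indep C H C' H' f : cell C H -> cell C' H' -> hperiodic H f -> hperiodic H' f ->
  avg C f = avg C' f.
Proof.
move=> cC cC' fH fH'; rewrite -[LHS](avg_cst cC') -[RHS](avg_cst cC).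
transitivity (avg C' (fun k => avg C (fun c => f (c * k)%g))).
  by congr avg; apply/funext => k; rewrite (avg_right cC).
transitivity (avg C (fun c => avg C' (fun k => f (c * k)%g))); last first.
  by congr avg; apply/funext => k; rewrite (avg_left cC').
have [[_ _ fC] [_ _ fC']] := (cC, cC').
rewrite /avg !fsum_fset// !mulr_sumr.
under eq_bigr do rewrite fsum_fset// !mulr_sumr.
rewrite exchange_big/=; apply: eq_bigr => c _; rewrite fsum_fset// !mulr_sumr.
by apply: eq_bigr => k _; rewrite mulrCA.
Qed.

End CellAverage.

(* The cross terms D_i f_j D_j f_i sum, by parts, to the mean square of the
   discrete divergence. *)
Lemma lattice_korn (R : realType) (gT : groupType) (C H : set gT) (n : nat)
    (t : 'I_n -> gT) (f : 'I_n -> gT -> R) :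
  cell C H -> (forall i, hperiodic H (f i)) ->
  (forall i j, t i * t j = t j * t i)%g ->
  let D i j g := f j (t i * g)%g - f j g in
  2 * \sum_i \sum_j avg C (fun g => D i j g ^+ 2) <=
    \sum_i \sum_j avg C (fun g => (D i j g + D j i g) ^+ 2).
Proof.
move=> cC fH tt; rewrite /=; set D := fun i j g => f j (t i * g)%g - f j g.
pose D' i g := f i ((t i)^-1 * g)%g - f i g.
have hl i h g s : H s -> f i (h * (g * s))%g = f i (h * g)%g.
  by move=> Hs; rewrite mulgA [LHS]fH.

have cross i j : avg C (fun g => D i j g * D j i g) = avg C (fun g => D' i g * D' j g).
  pose a g := f j (t i * g)%g * f i (t j * g)%g.
  pose b g := f j (t i * g)%g * f i g.
  pose c g := f j g * f i (t j * g)%g.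
  pose e g := f j g * f i g.
  have eN (x : gT -> R) : avg C (fun g => - x g) = - avg C x.
    by rewrite -mulN1r -(avgZ cC); congr avg; apply/funext => g; rewrite mulN1r.
  transitivity (avg C a - avg C b - avg C c + avg C e).
    rewrite -!eN -!(avgD cC); congr avg; apply/funext => g.
    by rewrite /D /a /b /c /e; ring.
  (* Shifting [a], [b] and [c] by suitable translations leaves their means unchanged and turns the
     forward differences [D] into the backward differences [D']. *)
  rewrite -(avg_left cC ((t i)^-1 * (t j)^-1)%g (f := a)); last first.
    by move=> g s Hs; rewrite /a !(hl _ _ _ _ Hs).
  rewrite -(avg_left cC (t i)^-1%g (f := b)); last first.
    by move=> g s Hs; rewrite /b (fH _ _ _ Hs) !(hl _ _ _ _ Hs).
  rewrite -(avg_left cC (t j)^-1%g (f := c)); last first.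
    by move=> g s Hs; rewrite /c (fH _ _ _ Hs) !(hl _ _ _ _ Hs).
  rewrite -!eN -!(avgD cC); congr avg; apply/funext => g.
  rewrite /D' /a /b /c /e !mulgA !mulgV !mul1g.
  have -> : (t j * (t i)^-1 * (t j)^-1 = (t i)^-1)%g.
    by apply: (mulgI (t i)); rewrite !mulgA tt mulgK !mulgV.
  by ring.
have -> : \sum_i \sum_j avg C (fun g => (D i j g + D j i g) ^+ 2) =
    2 * \sum_i \sum_j avg C (fun g => D i j g ^+ 2) +
    2 * avg C (fun g => (\sum_i D' i g) ^+ 2).
  have -> : avg C (fun g => (\sum_i D' i g) ^+ 2) =
      \sum_i \sum_j avg C (fun g => D i j g * D j i g).
    transitivity (avg C (fun g => \sum_i \sum_j D' i g * D' j g)).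
      congr avg; apply/funext => g; rewrite expr2 mulr_suml.
      by apply: eq_bigr => i _; rewrite mulr_sumr.
    rewrite (avg_sum cC); apply: eq_bigr => i _; rewrite (avg_sum cC).
    by apply: eq_bigr => j _; rewrite cross.
  transitivity (\sum_i \sum_j (avg C (fun g => D i j g ^+ 2) + avg C (fun g => D j i g ^+ 2)
      + 2 * avg C (fun g => D i j g * D j i g))).
    apply: eq_bigr => i _; apply: eq_bigr => j _; rewrite -(avgZ cC) -!(avgD cC).
    by congr avg; apply/funext => g; ring.
  under eq_bigr do rewrite !big_split/=.
  rewrite !big_split/=; congr (_ + _).
    by rewrite mulr_natl mulr2n; congr (_ + _); rewrite exchange_big.
  by rewrite mulr_sumr; apply: eq_bigr => i _; rewrite mulr_sumr.
by rewrite lerDl mulr_ge0// (avg_ge0 cC)// => g; rewrite sqr_ge0.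
Qed.

(** * Orthogonal projection on the rigid displacements *)

Lemma orth_proj_exists (R : realType) (X : lmodType R) (dt : X -> X -> R)
    (I : eqType) (phi : I -> X -> R) (s : seq I) :
  (forall a x y z, dt (a *: x + y) z = a * dt x z + dt y z) ->
  (forall x y, dt x y = dt y x) ->
  (forall i a x y, phi i (a *: x + y) = a * phi i x + phi i y) ->
  forall W : set X, W 0 ->
  (forall a x y, W x -> W y -> W (a *: x + y)) ->
  (forall x, W x -> (forall i, i \in s -> phi i x = 0) -> x = 0) ->
  (forall x, W x -> dt x x = 0 -> x = 0) ->
  forall v, exists2 w, W w & forall w', W w' -> dt w' (v - w) = 0.
Proof.
move=> dtl dtC phil.
have dtr a x y z : dt z (a *: x + y) = a * dt z x + dt z y by rewrite dtC dtl !(dtC z).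
have dtB z x y : dt z (x - y) = dt z x - dt z y.
  by rewrite addrC -scaleN1r dtr mulN1r addrC.
have dt0 z : dt 0 z = 0.
  by have := dtl (-1) 0 0 z; rewrite scaler0 addr0 mulN1r addNr.
have phi0 i : phi i 0 = 0.
  by have := phil i (-1) 0 0; rewrite scaler0 addr0 mulN1r addNr.
elim: s => [|i s IH] W W0 WD sep pos v.
  by exists 0 => // w' Ww'; rewrite (sep w')// dt0.
have [phiW|] := pselect (forall w, W w -> phi i w = 0).
  by apply: IH => // x Wx hx; apply: sep => // j; rewrite inE => /predU1P[->|/hx//]; exact: phiW.
move=> /existsNP[w1 /not_implyP[Ww1 /eqP pw1]].
pose W' := [set w | W w /\ phi i w = 0].
have {}IH : forall v, exists2 w, W' w & forall w', W' w' -> dt w' (v - w) = 0.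
  apply: IH.
  - by split.
  - by move=> a x y [Wx px] [Wy py]; split; [exact: WD | rewrite phil px py mulr0 addr0].
  - by move=> x [Wx px] hx; apply: sep => // j; rewrite inE => /predU1P[->//|]; exact: hx.
  - by move=> x [Wx _]; exact: pos.
have [w10 [Ww10 pw10] w10P] := IH w1.
(* [w1] minus its projection on the kernel [W']: orthogonal to [W'] and not killed by [phi i]. *)
pose e := (-1) *: w10 + w1.
have eE : e = w1 - w10 by rewrite /e scaleN1r addrC.
have We : W e by exact: WD.
have pe : phi i e != 0 by rewrite /e phil pw10 mulr0 add0r.
have ee : dt e e != 0.
  by apply: contra_neq pe => /(pos _ We) ->; rewrite phi0.
have [w0 [Ww0 pw0] w0P] := IH v.
pose c := dt e v / dt e e.
have e0 w : W' w -> dt w e = 0 by move=> W'w; rewrite eE w10P.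
exists (c *: e + w0); first exact: WD.
move=> w' Ww'.
pose b := phi i w' / phi i e.
have -> : w' = b *: e + ((- b) *: e + w') by rewrite addrA -scalerDl subrr scale0r add0r.
have W'w : W' ((- b) *: e + w').
  by split; [exact: WD | rewrite phil /b mulNr divfK// addNr].
have E z : dt z (v - (c *: e + w0)) = dt z (v - w0) - c * dt z e.
  by rewrite !dtB dtr; ring.
rewrite dtl !E (w0P _ W'w) (e0 _ W'w) mulr0 subrr addr0 dtB.
by rewrite (dtC e w0) (e0 w0)// subr0 /c divfK// subrr mulr0.
Qed.

(** * Symmetrized displacements and the defect of a patch *)

Section Patch.
Context {R : realType} {d1 d2 : nat}.
Local Notation d := (d1 + d2)%N.
Variables (G : groupClosed (euclid R d)) (x0 : 'cV[R]_d).
Implicit Types (g h k : elt G) (P : set (elt G)) (u v w : elt G -> 'cV[R]_d).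

Local Notation lg g := (lin (val g)).

Lemma lin_orth g : orthogonal_mx (lg g).
Proof. exact: isom_pairP. Qed.

Lemma trlin_orth g : orthogonal_mx (lg g)^T.
Proof. exact: (lin_orth g^-1%g). Qed.

Lemma linK g : (lg g)^T *m lg g = 1%:M.
Proof. exact/eqP/lin_orth. Qed.

Lemma linVK g : lg g *m (lg g)^T = 1%:M.
Proof. by have := trlin_orth g; rewrite /orthogonal_mx trmxK => /eqP. Qed.

Lemma linM g h : lg (g * h)%g = lg g *m lg h.
Proof. by []. Qed.

Lemma linV g : lg g^-1%g = (lg g)^T.
Proof. by []. Qed.

Lemma act_mul g h x : act (val (g * h)%g) x = act (val g) (act (val h) x).
Proof.
rewrite /act linM -[tra (val (g * h)%g)]/(tra (val g) + lg g *m tra (val h)).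
by rewrite mulmxDr mulmxA -addrA [_ + tra (val g)]addrC.
Qed.

Lemma act_one x : act (val (1%g : elt G)) x = x.
Proof.
by rewrite /act -[lin _]/(1%:M : 'M[R]_d) -[tra _]/(0 : 'cV[R]_d) mul1mx addr0.
Qed.

Lemma actB g x y : act (val g) x - act (val g) y = lg g *m (x - y).
Proof. by rewrite /act mulmxBr; apply/matrixP => i j; rewrite !mxE; ring. Qed.

Lemma actD g x y : act (val g) (x + y) = act (val g) x + lg g *m y.
Proof. by rewrite /act mulmxDr addrAC. Qed.

Lemma stab1 : stab x0 (1%g : elt G).
Proof. exact: act_one. Qed.

Lemma stabM k h : stab x0 k -> stab x0 h -> stab x0 (k * h)%g.
Proof. by rewrite /stab/= act_mul => kx ->. Qed.

Lemma stabV k : stab x0 k -> stab x0 k^-1%g.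
Proof.
by rewrite /stab/= => kx; have := act_mul k^-1%g k x0; rewrite kx mulVg act_one.
Qed.

Lemma act_stab g h : stab x0 h -> act (val (g * h)%g) x0 = act (val g) x0.
Proof. by move=> hx; rewrite act_mul hx. Qed.

Hypothesis fin_stab : finite_set (stab x0 : set (elt G)).

Lemma stab_size : (0 < size (fset_set (stab x0 : set (elt G))))%N.
Proof.
have : (1%g : elt G) \in fset_set (stab x0) by rewrite in_fset_set// inE; exact: stab1.
move=> h; have {h} : (1%g : elt G) \in enum_fset (fset_set (stab x0)) by exact: h.
by case: (enum_fset _).
Qed.

Lemma cardR_stab : cardR (stab x0 : set (elt G)) = (size (fset_set (stab x0 : set (elt G))))%:R :> R.
Proof. by []. Qed.

Lemma barE u g : bar x0 u g = (cardR (stab x0 : set (elt G)))^-1 *: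
  \sum_(k <- fset_set (stab x0)) (lg k *m u (g * k)%g).
Proof. by rewrite /bar fsum_fset. Qed.

Lemma bar_lin a u v g : bar x0 (a *: u + v) g = a *: bar x0 u g + bar x0 v g.
Proof.
rewrite !barE scalerA mulrC -scalerA -scalerDr; congr (_ *: _).
rewrite scaler_sumr -big_split/=; apply: eq_bigr => k _.
by rewrite mulmxDr -scalemxAr.
Qed.

Lemma barB u v g : bar x0 (u - v) g = bar x0 u g - bar x0 v g.
Proof. by have := bar_lin (-1) v u g; rewrite !scaleN1r addrC => ->; rewrite addrC. Qed.

Lemma bar0 g : bar x0 (0 : elt G -> 'cV[R]_d) g = 0.
Proof. by rewrite -[0](subrr 0) barB subrr. Qed.

Lemma bar_shift u g k : bar x0 (fun h => u (g * h)%g) k = bar x0 u (g * k)%g.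
Proof. by rewrite !barE; under eq_bigr do rewrite mulgA. Qed.

Lemma nsq_bar u g B : (forall k, stab x0 k -> nsq (u (g * k)%g) <= B) ->
  nsq (bar x0 u g) <= B.
Proof.
move=> uB; rewrite barE cardR_stab; apply: nsq_avg; first exact: stab_size.
by move=> k; rewrite in_fset_set// inE => /uB; rewrite nsq_orth//; exact: lin_orth.
Qed.

Lemma bar_fixed u g : (forall k, stab x0 k -> lg k *m u (g * k)%g = u g) ->
  bar x0 u g = u g.
Proof.
move=> h; rewrite barE big_seq (eq_bigr (fun=> u g)); last first.
  by move=> k; rewrite in_fset_set// inE => /h.
rewrite -big_seq big_const_seq count_predT iter_addr addr0 -scaler_nat scalerA.
by rewrite mulVf ?scale1r// pnatr_eq0 -lt0n stab_size.
Qed.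

Section Projection.
Variable P : set (elt G).
Hypotheses (fP : finite_set P) (PS : mul_set P (stab x0) = P).

Lemma dotE u v : dot P u v = \sum_(h <- fset_set P) ip (u h) (v h).
Proof. by rewrite /dot fsum_fset. Qed.

Lemma dot_ge0 u : 0 <= dot P u u.
Proof. by rewrite dotE sumr_ge0// => h _; exact: nsq_ge0. Qed.

Lemma dot_term u h : P h -> nsq (u h) <= dot P u u.
Proof.
move=> Ph; rewrite dotE (big_fsetD1 h)/= ?in_fset_set ?inE// lerDl.
by rewrite sumr_ge0// => k _; exact: nsq_ge0.
Qed.

Lemma patchP W (f : elt G -> W) (z : elt G -> W) h : P h -> patch z P f h = f h.
Proof. by move=> Ph; rewrite /patch mem_set. Qed.

Lemma mulP_stab k h : P k -> stab x0 h -> P (k * h)%g.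
Proof. by move=> Pk Sh; rewrite -PS; exists k => //; exists h. Qed.

Lemma bar_patch v k : P k -> bar x0 (patch (fun=> 0) P v) k = bar x0 v k.
Proof.
move=> Pk; rewrite !barE; congr (_ *: _); apply: eq_big_seq => l.
by rewrite in_fset_set// inE => Sl; rewrite patchP//; exact: mulP_stab.
Qed.

Variable Sk : set 'M[R]_d.
Hypotheses (Sk0 : Sk 0) (SkL : forall a A B, Sk A -> Sk B -> Sk (a *: A + B)).

Definition proj v := orth_proj_ker P (Uiso x0 P Sk) (patch (fun=> 0) P v).

Lemma projP v : [/\ funs_on P (proj v),
  forall w, Uiso x0 P Sk w -> dot P (proj v) w = 0 &
  Uiso x0 P Sk (patch (fun=> 0) P v - proj v)].
Proof.
rewrite /proj /orth_proj_ker.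
apply: (@xgetPex _ (fun=> 0) [set p | [/\ funs_on P p, forall w, Uiso x0 P Sk w -> dot P p w = 0
                            & Uiso x0 P Sk (patch (fun=> 0) P v - p)]]).
set pv := patch _ _ _.
have vP : funs_on P pv by move=> g nP; rewrite /pv /patch memNset.
(* The coordinates at the points of the finite set [P] separate the functions supported on [P]. *)
pose phi (q : elt G * 'I_d) (u : elt G -> 'cV[R]_d) := u q.1 q.2 0.
pose s := [seq (g, i) | g <- fset_set P, i <- enum 'I_d].
have dotl a x y z : dot P (a *: x + y) z = a * dot P x z + dot P y z.
  rewrite !dotE mulr_sumr -big_split; apply: eq_bigr => h _ /=.
  by rewrite ipDl ipZl.
have dotC x y : dot P x y = dot P y x.
  by rewrite !dotE; apply: eq_bigr => h _; rewrite ipC.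
have [w Ww wP] : exists2 w, Uiso x0 P Sk w &
    forall w', Uiso x0 P Sk w' -> dot P w' (pv - w) = 0.
  apply: (orth_proj_exists (phi := phi) (s := s) dotl dotC).
  - by move=> q a x y; rewrite /phi !mxE.
  - by split => //; exists 0, 0; split => // g _; rewrite bar0 mulmx0 mul0mx addr0.
  - move=> a x y [xP [ax [Sx [SSx hx]]]] [yP [ay [Sy [SSy hy]]]]; split.
      by move=> g nP; rewrite -[LHS]/(a *: x g + y g) xP// yP// scaler0 addr0.
    exists (a *: ax + ay), (a *: Sx + Sy); split; first exact: SkL.
    move=> g Pg; rewrite bar_lin mulmxDr -scalemxAr hx// hy// mulmxDl -scalemxAl scalerDr.
    by rewrite addrACA.
  - move=> x [xP _] hx; apply/funext => g; have [Pg|/xP//] := pselect (P g).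
    apply/matrixP => i j; rewrite ord1 [RHS]mxE; apply: (hx (g, i)).
    by apply/allpairsP; exists (g, i); rewrite mem_enum; split=> //; rewrite -[_ \in _]/(_ \in fset_set P) in_fset_set// inE.
  - move=> x [xP _] hx; apply/funext => g; have [Pg|/xP//] := pselect (P g).
    by apply: nsq_eq0; rewrite -hx; exact: dot_term.
exists (pv - w); split.
- by move=> g nP; case: Ww => wf _; rewrite -[LHS]/(pv g - w g) vP// wf// subr0.
- by move=> w' /wP; rewrite dotC.
- by rewrite opprB addrC subrK.
Qed.

(** The contribution of a single group element to the squared seminorm. *)
Definition defect v : R := dot P (proj v) (proj v).

Lemma defect_ge0 v : 0 <= defect v.
Proof. exact: dot_ge0. Qed.

Lemma defect0 v : defect v <= 0 -> Uiso x0 P Sk (patch (fun=> 0) P v).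
Proof.
move=> v0; have [vP _] := projP v.
suff -> : proj v = 0 by rewrite subr0.
apply/funext => g; have [Pg|/vP//] := pselect (P g).
by apply: nsq_eq0; apply: le_trans v0; exact: dot_term.
Qed.

(** Subtracting the projection leaves an element of [Uiso], which supplies the motion. The error is
    the symmetrization of [proj v], an average over points of [P] of vectors bounded by the defect.
    Choosing the motion as a function of [v] lets it inherit the periodicity of the displacement. *)
Lemma rigid_approx v : {aS : 'cV[R]_d * 'M[R]_d | Sk aS.2 /\
  forall k, P k -> nsq (lg k *m bar x0 v k - aS.1 - aS.2 *m (act (val k) x0 - x0)) <= defect v}.
Proof.
apply: cid; have [_ _ [_ [a [S [SS h]]]]] := projP v.
exists (a, S); split=> // k Pk /=.
have := h _ Pk; rewrite barB mulmxBr => /eqP; rewrite subr_eq => /eqP e.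
rewrite -(bar_patch _ Pk) e [X in nsq X](_ : _ = lg k *m bar x0 (proj v) k); last first.
  by apply/matrixP => i j; rewrite !mxE; ring.
rewrite nsq_orth; last exact: lin_orth.
by apply: nsq_bar => l Sl; apply: dot_term; exact: mulP_stab.
Qed.

End Projection.
End Patch.

(** * Propagation of rigidity *)

Section Rigidity.
Context {R : realType} {d1 d2 : nat}.
Local Notation d := (d1 + d2)%N.
Variables (G : groupClosed (euclid R d)) (x0 : 'cV[R]_d) (P : set (elt G)).
Implicit Types (g h k : elt G) (v w : 'cV[R]_d).

Local Notation lg g := (lin (val g)).

(* Seen from g, the displacement [field] of the patch g P is an infinitesimal
   isometry with translation [pshift g] and rotation [spin g], up to the error
   [dev g]. *)
Record patches := Patches {
  cellC : set (elt G); cellH : set (elt G);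
  field : elt G -> 'cV[R]_d; pshift : elt G -> 'cV[R]_d;
  spin : elt G -> 'M[R]_d; dev : elt G -> R;
  patches_cell : cell cellC cellH;
  field_per : hperiodic cellH field; pshift_per : hperiodic cellH pshift;
  spin_per : hperiodic cellH spin; dev_per : hperiodic cellH dev;
  cell_trans : forall t, cellH t -> lg t = 1%:M;
  spin_skew : forall g, Skew (spin g);
  patches_dev : forall g k, P k ->
    nsq (lg k *m field (g * k)%g - pshift g - spin g *m (act (val k) x0 - x0)) <= dev g }.

Implicit Types (D : patches) (F : patches -> elt G -> 'cV[R]_d).

(** Meant for every [k], also outside [P]: the error made when the rigid motion of the patch at [g]
    is extrapolated to [g * k]. *)
Definition gap k D g : 'cV[R]_d :=
  lg k *m field D (g * k)%g - pshift D g - spin D g *m (act (val k) x0 - x0).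

(** Compares the rotations at [g * k] and at [g], both expressed in the frame of [g]. *)
Definition twist k D g : 'M[R]_d := lg k *m spin D (g * k)%g *m (lg k)^T - spin D g.

(** The constant precedes [D], hence serves all displacements and all periods at once. *)
Definition dominated (f : patches -> elt G -> R) := exists2 c, 0 <= c &
  forall D, avg (cellC D) (f D) <= c * avg (cellC D) (dev D).

Definition msdom F := dominated (fun D g => nsq (F D g)).

Definition periodic_field F := forall D, hperiodic (cellH D) (F D).

Hypothesis P1 : P 1%g.

Lemma le_dominated f f' : (forall D g, f D g <= f' D g) -> dominated f' -> dominated f.
Proof.
move=> ff [c c0 h]; exists c => // D; apply: le_trans (h D).
exact: (le_avg (patches_cell D)).
Qed.

Lemma dominatedD f f' : dominated f -> dominated f' ->
  dominated (fun D g => f D g + f' D g).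
Proof.
move=> [c c0 h] [c' c'0 h']; exists (c + c'); first exact: addr_ge0.
by move=> D; rewrite (avgD (patches_cell D)) mulrDl lerD.
Qed.

Lemma dominatedZ a f : 0 <= a -> dominated f -> dominated (fun D g => a * f D g).
Proof.
move=> a0 [c c0 h]; exists (a * c); first exact: mulr_ge0.
by move=> D; rewrite (avgZ (patches_cell D)) -mulrA ler_wpM2l.
Qed.

Lemma dominated0 : dominated (fun _ _ => 0).
Proof.
by exists 0 => // D; rewrite mul0r (avg_cst (patches_cell D)).
Qed.

Lemma dominated_sum (I : Type) (s : seq I) (f : I -> patches -> elt G -> R) :
  (forall i, dominated (f i)) -> dominated (fun D g => \sum_(i <- s) f i D g).
Proof.
move=> h; elim: s => [|i s IH].
  by apply: le_dominated dominated0 => D g; rewrite big_nil.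
by apply: le_dominated (dominatedD (h i) IH) => D g; rewrite big_cons.
Qed.

Lemma eq_msdom F F' : (forall D g, F D g = F' D g) -> msdom F -> msdom F'.
Proof.
by move=> FF; apply: le_dominated => D g; rewrite FF.
Qed.

Lemma msdom0 : msdom (fun _ _ => 0).
Proof.
by apply: le_dominated dominated0 => D g; rewrite ip0r.
Qed.

Lemma msdomD F F' : msdom F -> msdom F' -> msdom (fun D g => F D g + F' D g).
Proof.
move=> hF hF'; apply: le_dominated (dominatedZ _ (dominatedD hF hF')) => [D g|].
  exact: nsqD.
by [].
Qed.

Lemma msdom_mul (M : 'M[R]_d) F : msdom F -> msdom (fun D g => M *m F D g).
Proof.
move=> hF; apply: le_dominated (dominatedZ _ hF) => [D g|]; first exact: nsq_mul.
by apply: sumr_ge0 => i _; apply: sumr_ge0 => j _; exact: sqr_ge0.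
Qed.

Lemma msdomZ a F : msdom F -> msdom (fun D g => a *: F D g).
Proof.
by move=> /(msdom_mul (a%:M)); apply: eq_msdom => D g; rewrite mul_scalar_mx.
Qed.

Lemma msdomN F : msdom F -> msdom (fun D g => - F D g).
Proof. by move=> /(msdomZ (-1)); apply: eq_msdom => D g; rewrite scaleN1r. Qed.

Lemma msdomB F F' : msdom F -> msdom F' -> msdom (fun D g => F D g - F' D g).
Proof. by move=> hF /msdomN; exact: msdomD. Qed.

Lemma msdom_shift F k : periodic_field F -> msdom F -> msdom (fun D g => F D (g * k)%g).
Proof.
move=> pF [c c0 h]; exists c => // D.
rewrite (@avg_right _ _ _ _ (patches_cell D) (fun g => nsq (F D g)))// => g t Ht.
by rewrite pF.
Qed.

Lemma hperiodic_mulr W (D : patches) (f : elt G -> W) k : hperiodic (cellH D) f ->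
  hperiodic (cellH D) (fun g => f (g * k)%g).
Proof.
move=> fH g t Ht; have -> : (g * t * k = g * k * (k^-1 * t * k))%g.
  by rewrite !mulgA mulgK.
by rewrite fH//; exact: normal_conj (patches_cell D) _ _ Ht.
Qed.

Lemma gap_per k : periodic_field (gap k).
Proof.
move=> D g t Ht; rewrite /gap (hperiodic_mulr k (@field_per D))//.
by rewrite (@pshift_per D)// (@spin_per D).
Qed.

Lemma twist_per k w : periodic_field (fun D g => twist k D g *m w).
Proof.
move=> D g t Ht; rewrite /twist (hperiodic_mulr k (@spin_per D))//.
by rewrite (@spin_per D).
Qed.

Lemma gap_dev k : P k -> msdom (gap k).
Proof.
move=> Pk; exists 1 => // D; rewrite mul1r.
by apply: (le_avg (patches_cell D)) => g; exact: patches_dev.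
Qed.

(** The displacement at [g * k * k'] is predicted from [g] directly and by way of [g * k]; the
    predictions differ through the rotations at the two places. The gap at the identity enters
    because the shift at [g * k] is only approximately the displacement there. *)
Lemma gap_mul k k' D g : gap (k * k')%g D g =
  lg k *m gap k' D (g * k)%g + gap k D g - lg k *m gap 1%g D (g * k)%g +
  twist k D g *m (lg k *m (act (val k') x0 - x0)).
Proof.
rewrite /gap /twist mulmxBl !mulmxA -(mulmxA _ (lg k)^T) linK mulmx1.
rewrite -(mulmxA (spin D g)) -actB -act_mul act_one subrr mulmx0 subr0.
rewrite mulgA !mulg1 linM !mulmxBr !mulmxA -[lg (1%g : elt G)]/(1%:M : 'M[R]_d) mulmx1.
apply/matrixP => i j; rewrite !mxE; ring.
Qed.

Lemma twist_mul k k' w D g : twist (k * k')%g D g *m w =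
  lg k *m (twist k' D (g * k)%g *m ((lg k)^T *m w)) + twist k D g *m w.
Proof.
rewrite /twist linM trmx_mul mulgA !mulmxBl !mulmxBr !mulmxA.
by rewrite addrA subrK.
Qed.

Lemma twist_inv k w D g : twist k^-1%g D g *m w =
  - ((lg k)^T *m (twist k D (g * k^-1)%g *m (lg k *m w))).
Proof.
rewrite /twist linV trmxK !mulmxBl !mulmxBr !mulmxA linK mul1mx.
by rewrite mulgVK -(mulmxA _ (lg k)^T) linK mulmx1 opprB.
Qed.

(** These are the differences of two orbit points, the vectors on which neighbouring rotations can
    be compared; the set is stable under the linear parts of the group. *)
Definition directions : set 'cV[R]_d :=
  [set w | exists k k', w = lg k *m (act (val k') x0 - x0)].

Lemma directions_lin k w : directions w -> directions (lg k *m w).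
Proof. by move=> [k1 [k' ->]]; exists (k * k1)%g, k'; rewrite mulmxA. Qed.

Definition rigid : set (elt G) := [set k | msdom (gap k) /\
  forall w, directions w -> msdom (fun D g => twist k D g *m w)].

Lemma rigidM k k' : rigid k -> rigid k' -> rigid (k * k')%g.
Proof.
move=> [gk tk] [gk' tk']; split.
  apply: (@eq_msdom (fun D g => lg k *m gap k' D (g * k)%g + gap k D g -
     lg k *m gap 1%g D (g * k)%g +
     twist k D g *m (lg k *m (act (val k') x0 - x0)))); first by move=> D g; rewrite gap_mul.
  apply: msdomD; last by apply: tk; exists k, k'.
  apply: msdomB; last by apply/msdom_mul/(msdom_shift k (@gap_per _))/gap_dev.
  by apply: msdomD => //; apply/msdom_mul/(msdom_shift k (@gap_per _)).
move=> w Dw.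
apply: (@eq_msdom (fun D g => lg k *m (twist k' D (g * k)%g *m ((lg k)^T *m w)) + twist k D g *m w)).
  by move=> D g; rewrite twist_mul.
apply: msdomD; last exact: tk.
by apply/msdom_mul/(msdom_shift k (@twist_per _ _))/tk'/(directions_lin k^-1%g).
Qed.

Lemma rigidV k : rigid k -> rigid k^-1%g.
Proof.
move=> [gk tk].
have tV w : directions w -> msdom (fun D g => twist k^-1%g D g *m w).
  move=> Dw; apply: (@eq_msdom (fun D g => - ((lg k)^T *m (twist k D (g * k^-1)%g *m (lg k *m w))))).
    by move=> D g; rewrite twist_inv.
  by apply/msdomN/msdom_mul/(msdom_shift k^-1%g (@twist_per _ _))/tk/directions_lin.
split=> //.
(* The identity [gap_mul] for the product [k^-1 * k], solved for the gap of [k^-1]. *)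
apply: (@eq_msdom (fun D g => gap 1%g D g - lg k^-1%g *m gap k D (g * k^-1)%g +
  lg k^-1%g *m gap 1%g D (g * k^-1)%g -
  twist k^-1%g D g *m (lg k^-1%g *m (act (val k) x0 - x0)))).
  move=> D g; have := gap_mul k^-1%g k D g; rewrite mulVg => ->.
  by apply/matrixP => i j; rewrite !mxE; ring.
apply: msdomB; last by apply: tV; exists k^-1%g, k.
apply: msdomD; last by apply/msdom_mul/(msdom_shift k^-1%g (@gap_per _))/gap_dev.
apply: msdomB; first exact: gap_dev.
exact/msdom_mul/(msdom_shift k^-1%g (@gap_per _)).
Qed.

(** The coefficients of an affine combination sum to 1, so subtracting [x0] turns it into a linear
    combination of differences. *)
Lemma orbit_aff (A : set (elt G)) k : aff (orbit_of G x0 A) = aff (orbit_of G x0 setT) ->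
  exists n (c : 'I_n -> R) (r : 'I_n -> elt G), (forall i, A (r i)) /\
   act (val k) x0 - x0 = \sum_i c i *: (act (val (r i)) x0 - x0).
Proof.
move=> aE; have : aff (orbit_of G x0 setT) (act (val k) x0).
  exists 1%N, (fun=> act (val k) x0), (fun=> 1).
  by split; [move=> _; exists k| rewrite big_ord1| rewrite big_ord1 scale1r].
rewrite -aE => -[n [p [c [Ap c1 ->]]]].
have [r rP] := @choice _ _ (fun i g => A g /\ act (val g) x0 = p i)
  (fun i => ltac:(by have [g Ag gp] := Ap i; exists g)).
exists n, c, r; split=> [i|]; first by case: (rP i).
under [RHS]eq_bigr do rewrite scalerBr; rewrite sumrB; congr (_ - _).
  by apply: eq_bigr => i _; case: (rP i) => _ ->.
by rewrite -scaler_suml c1 scale1r.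
Qed.

(** For [k] in [A''] the elements [r], [k] and [r * k] all lie in [P], so every gap in [gap_mul] is
    bounded by a defect and the identity can be solved for the twist. As [A''] spans the orbit
    affinely, this extends to all directions. *)
Lemma rigid_patch (A' A'' : set (elt G)) r : mul_set A' A'' `<=` P ->
  A' 1%g -> A'' 1%g -> aff (orbit_of G x0 A'') = aff (orbit_of G x0 setT) ->
  A' r -> rigid r.
Proof.
move=> AP A'1 A''1 aE A'r.
have Pmul a b : A' a -> A'' b -> P (a * b)%g by move=> Aa Ab; apply: AP; exists a => //; exists b.
have Pr : P r by rewrite -[r]mulg1; exact: Pmul.
split; first exact: gap_dev.
have base k : A'' k -> msdom (fun D g => twist r D g *m (lg r *m (act (val k) x0 - x0))).
  move=> Ak; apply: (@eq_msdom (fun D g => gap (r * k)%g D g -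
    (lg r *m gap k D (g * r)%g + gap r D g - lg r *m gap 1%g D (g * r)%g))).
    by move=> D g; rewrite gap_mul addrAC subrr add0r.
  apply: msdomB; first by apply/gap_dev/Pmul.
  have Pk : P k by rewrite -[k]mul1g; exact: Pmul.
  apply: msdomB; last by apply/msdom_mul/(msdom_shift r (@gap_per _))/gap_dev.
  by apply: msdomD; [apply/msdom_mul/(msdom_shift r (@gap_per _))/gap_dev|exact: gap_dev].
have all k : msdom (fun D g => twist r D g *m (lg r *m (act (val k) x0 - x0))).
  have [n [c [s [As ->]]]] := orbit_aff k aE.
  apply: (@eq_msdom (fun D g => \sum_i c i *: (twist r D g *m (lg r *m (act (val (s i)) x0 - x0))))).
    move=> D g; rewrite !mulmx_sumr; apply: eq_bigr => i _.
    by rewrite -!scalemxAr.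
  elim: (index_enum _) => [|i e IH].
    by apply: eq_msdom msdom0 => D g; rewrite big_nil.
  apply: (@eq_msdom (fun D g => c i *: (twist r D g *m (lg r *m (act (val (s i)) x0 - x0))) +
    \sum_(i <- e) c i *: (twist r D g *m (lg r *m (act (val (s i)) x0 - x0))))).
    by move=> D g; rewrite big_cons.
  by apply: msdomD => //; exact/msdomZ/base.
move=> w [k [k' ->]].
(* Any direction is a difference of two vectors of the form just treated, after moving it by
   [r^-1]. *)
apply: (@eq_msdom (fun D g => twist r D g *m (lg r *m (act (val (r^-1 * k * k')%g) x0 - x0)) -
   twist r D g *m (lg r *m (act (val (r^-1 * k)%g) x0 - x0)))); last exact: msdomB.
move=> D g; rewrite -!mulmxBr; congr (_ *m _).
rewrite opprB addrA subrK !act_mul !actB linV [LHS]mulmxA linVK mul1mx.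
by [].
Qed.

(** The set [rigid] is a subgroup by [rigidM] and [rigidV] and contains the generating set [A'], so
    it is everything. *)
Lemma gap_msdom : admissible x0 P -> forall k, msdom (gap k).
Proof.
move=> [_ _ [A' [A'' [AP hAB genA aE]]]] k.
have [hA hB] : A' 1%g /\ A'' 1%g by [].
have closed : group_closed [in rigid].
  have r1 : rigid 1%g by exact: (rigid_patch AP hA hB aE hA).
  split; first by rewrite inE.
  move=> g h; rewrite !inE => rg rh.
  by apply: rigidM => //; exact: rigidV.
have rT := genA rigid closed (fun r => rigid_patch AP hA hB aE (r := r)).
by have [] : rigid k by rewrite rT.
Qed.

End Rigidity.

(** * Korn's inequality *)

Section Korn.
Context {R : realType} {d1 d2 : nat}.
Local Notation d := (d1 + d2)%N.
Variables (G : groupClosed (euclid R d)) (x0 : 'cV[R]_d) (P : set (elt G)).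
Variables (t : 'I_d -> elt G) (K : set (elt G)).
Implicit Types (g h k : elt G) (D : patches x0 P).

Local Notation lg g := (lin (val g)).
Local Notation b i := (tra (val (t i))).

Hypotheses (adP : admissible x0 P) (P1 : P 1%g).
Hypotheses (t1 : forall i, lg (t i) = 1%:M) (tK : forall g i, K (g^-1 * t i * g)%g)
  (fK : finite_set K) (tfree : row_free (\matrix_i (tra (val (t i)))^T)).

Lemma trans_comm i j : (t i * t j = t j * t i)%g.
Proof.
apply/val_inj/val_inj.
change ((lg (t i) *m lg (t j), b i + lg (t i) *m b j) =
        (lg (t j) *m lg (t i), b j + lg (t j) *m b i)).
by rewrite !t1 !mul1mx addrC.
Qed.

Lemma act_conj_trans g i :
  act (val (g^-1 * t i * g)%g) x0 - x0 = (lg g)^T *m b i.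
Proof.
have e : act (val g^-1%g) (act (val g) x0) = x0 by rewrite -act_mul mulVg act_one.
rewrite !act_mul -[X in _ - X]e actB linV; congr (_ *m _).
by rewrite /act t1 mul1mx [LHS]addrC addKr.
Qed.

(** Displacement and spin in the fixed frame of space rather than in the frame of [g]; [f] lists the
    components along the lattice basis and [dif] their differences along lattice translations. *)
Let U D g := lg g *m field D g.
Let f D i g := ip (b i) (U D g).
Let dif D i j g := f D j (t i * g)%g - f D j g.
Let spinr D g := lg g *m spin D g *m (lg g)^T.
Let err D i g := lg g *m (gap (g^-1 * t i * g)%g D g - gap 1%g D g).

(** Left translation by [t i] is right multiplication by the conjugate [g^-1 * t i * g], again a
    translation. Comparing the rigid prediction there with the one at the identity cancels the shift
    and leaves the spin. *)
Lemma difE D i j g : dif D i j g = ip (b j) (err D i g) + ip (b j) (spinr D g *m b i).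
Proof.
have tg : (t i * g = g * (g^-1 * t i * g))%g by rewrite !mulgA mulgV mul1g.
rewrite /dif /f /U linM t1 mul1mx {1}tg /err; set k := (g^-1 * t i * g)%g.
have lk : lg k = 1%:M by rewrite /k !linM t1 mulmx1 linV linK.
have e1 : field D g = gap 1%g D g + pshift D g.
  by rewrite /gap act_one subrr mulmx0 subr0 mulg1 -[lg 1%g]/(1%:M : 'M[R]_d) mul1mx subrK.
have ek : field D (g * k)%g = gap k D g + pshift D g + spin D g *m ((lg g)^T *m b i).
  by rewrite /gap act_conj_trans lk mul1mx addrAC !subrK.
rewrite {1}e1 ek /spinr -!mulmxA -ipNr -!ipDr -!mulmxN -!mulmxDr.
congr ip; congr (_ *m _); apply/matrixP => x y; rewrite !mxE; ring.
Qed.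

(** The conjugate in [err] varies with [g] but stays in the finite set [K], so a sum of gaps over
    [K] bounds it. *)
Lemma err_dominated i : dominated (fun D g => nsq (err D i g)).
Proof.
apply: (@le_dominated _ _ _ _ _ _ _ (fun D g => 2 * ((\sum_(k <- fset_set K) nsq (gap k D g)) + nsq (gap 1%g D g)))).
  move=> D g; rewrite nsq_orth; last exact: lin_orth.
  apply: le_trans (nsqB _ _) _; rewrite ler_pM2l// lerD2r.
  rewrite (big_fsetD1 (g^-1 * t i * g)%g)/= ?in_fset_set ?inE// lerDl.
  by rewrite sumr_ge0// => k _; exact: nsq_ge0.
apply: dominatedZ => //; apply: dominatedD; last exact: gap_msdom.
by apply: dominated_sum => k; exact: gap_msdom.
Qed.

Lemma ip_err_dominated i j : dominated (fun D g => ip (b j) (err D i g) ^+ 2).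
Proof.
apply: le_dominated (dominatedZ (nsq_ge0 (b j)) (err_dominated i)) => D g.
exact: ip_CS.
Qed.

Lemma skew_spinr D g i j : ip (b j) (spinr D g *m b i) = - ip (b i) (spinr D g *m b j).
Proof.
rewrite ipC ip_mull /spinr !trmx_mul trmxK (spin_skew D g : _^T = - _).
by rewrite mulNmx mulmxN mulNmx ipNr mulmxA.
Qed.

(** The spin is skew, hence drops out of [dif D i j + dif D j i]; only errors remain in the
    symmetric part, and [lattice_korn] recovers all differences from it. *)
Lemma dif_dominated i j : dominated (fun D g => dif D i j g ^+ 2).
Proof.
pose s D g : R := \sum_i \sum_j (dif D i j g + dif D j i g) ^+ 2.
have [c c0 sc] : dominated s.
  apply: dominated_sum => i'; apply: dominated_sum => j'.
  apply: le_dominated (dominatedZ (ler0n R 2) (dominatedD (ip_err_dominated i' j') (ip_err_dominated j' i'))) => D g.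
  rewrite !difE skew_spinr.
  set p := ip _ _; set q := ip _ _; set r := ip _ _.
  by have := sqr_ge0 (p - r); nra.
exists c => // D; apply: le_trans (sc D).
have cD := patches_cell D.
have fper i' : hperiodic (cellH D) (f D i').
  by move=> g h Hh; rewrite /f /U (@field_per _ _ _ _ _ _ D)// linM (@cell_trans _ _ _ _ _ _ D h)// mulmx1.
have := lattice_korn cD fper trans_comm; rewrite /= -/(dif D).
set A := \sum_i \sum_j _; set B := \sum_i _ => AB.
have -> : avg (cellC D) (s D) = B.
  rewrite /s (avg_sum cD); apply: eq_bigr => i' _; rewrite (avg_sum cD).
  by apply: eq_bigr => j' _.
have a0 i' j' : 0 <= avg (cellC D) (fun g => dif D i' j' g ^+ 2).
  by apply: (avg_ge0 cD) => g; exact: sqr_ge0.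
have A0 : 0 <= A by apply: sumr_ge0 => i' _; apply: sumr_ge0 => j' _; exact: a0.
apply: (@le_trans _ _ A); last lra.
rewrite /A (bigD1 i)//= (bigD1 j)//= -addrA lerDl.
apply: addr_ge0; first by apply: sumr_ge0 => j' _; exact: a0.
by apply: sumr_ge0 => i' _; apply: sumr_ge0 => j' _; exact: a0.
Qed.

(** In the lattice basis the entries of the spin are differences minus errors, all dominated; the
    invertible basis matrix [B] carries this back. *)
Lemma spin_msdom w : msdom (fun D g => spin D g *m w).
Proof.
pose B := \matrix_i (tra (val (t i)))^T.
have uB : B \in unitmx by rewrite -row_free_unit.
pose fr (M : 'M[R]_d) := \sum_i \sum_j M i j ^+ 2.
have fr0 M : 0 <= fr M by apply: sumr_ge0 => i _; apply: sumr_ge0 => j _; exact: sqr_ge0.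
apply: (@le_dominated _ _ _ _ _ _ _ (fun D g => (fr (invmx B) * fr (invmx B^T) * nsq w) *
   \sum_i \sum_j 2 * (dif D j i g ^+ 2 + ip (b i) (err D j g) ^+ 2))).
  move=> D g.
  have -> : spin D g *m w = (lg g)^T *m (spinr D g *m (lg g *m w)).
    by rewrite /spinr -!mulmxA !(mulmxA (lg g)^T (lg g)) linK !mul1mx.
  rewrite nsq_orth; last exact: trlin_orth.
  have -> : spinr D g *m (lg g *m w) =
      invmx B *m ((B *m spinr D g *m B^T) *m (invmx B^T *m (lg g *m w))).
    by rewrite -!mulmxA mulKVmx ?unitmx_tr// mulKmx.
  apply: le_trans (nsq_mul _ _) _; rewrite -/(fr _) -!mulrA ler_wpM2l//.
  apply: le_trans (nsq_mul _ _) _; rewrite -/(fr _) mulrC.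
  apply: le_trans (ler_wpM2r (fr0 _) (nsq_mul _ _)) _; rewrite -/(fr _).
  rewrite nsq_orth; last exact: lin_orth.
  rewrite -!mulrA ler_wpM2l// ler_wpM2l ?nsq_ge0//.
  apply: ler_sum => i _; apply: ler_sum => j _.
  have -> : (B *m spinr D g *m B^T) i j = dif D j i g - ip (b i) (err D j g).
    rewrite difE addrAC subrr add0r /ip mulmxA.
    rewrite -[RHS]/((_ *m _) 0 0) !mxE; apply: eq_bigr => l _; rewrite !mxE.
    by congr (_ * _); apply: eq_bigr => m _; rewrite !mxE.
  set p := dif _ _ _ _; set q := ip _ _.
  by have := sqr_ge0 (p + q); nra.
apply: dominatedZ; first by rewrite !mulr_ge0 ?nsq_ge0.
apply: dominated_sum => i; apply: dominated_sum => j; apply: dominatedZ => //.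
by apply: dominatedD; [exact: dif_dominated | exact: ip_err_dominated].
Qed.

End Korn.

(** * Directional derivatives *)

Section Slope.
Context {R : realType}.
Implicit Types (phi psi : R -> R).

Definition has_slope phi l := forall e, 0 < e -> exists2 r, 0 < r &
  forall s, `|s| < r -> `|phi s - phi 0 - s * l| <= e * `|s|.

Lemma eq_slope phi psi l : (exists2 r, 0 < r & forall s, `|s| < r -> phi s = psi s) ->
  has_slope phi l -> has_slope psi l.
Proof.
move=> [r r0 pp] h e e0; have [r' r'0 h'] := h e e0.
exists (Num.min r r'); first by rewrite lt_min r0.
move=> s; rewrite lt_min => /andP[sr sr']; rewrite -!pp ?normr0//.
exact: h'.
Qed.

Lemma slope_unique phi l l' : has_slope phi l -> has_slope phi l' -> l = l'.
Proof.
move=> h h'; apply/eqP; rewrite -subr_eq0 -normr_le0; apply/ler_addgt0Pr => e e0.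
have e2 : 0 < e / 2 by rewrite divr_gt0.
have [r r0 hr] := h _ e2; have [r' r'0 hr'] := h' _ e2.
pose s := Num.min r r' / 2.
have s0 : 0 < s by rewrite divr_gt0// lt_min r0.
have : s < Num.min r r' by rewrite ltr_pdivrMr// ltr_pMr ?ltr1n// lt_min r0.
have sE : `|s| = s by rewrite gtr0_norm.
rewrite lt_min => /andP[]; rewrite -{1 2}sE => /hr {}hr /hr' {}hr'.
rewrite add0r -(ler_pM2l s0) -{1}sE -normrM.
have -> : s * (l - l') = (phi s - phi 0 - s * l') - (phi s - phi 0 - s * l) by ring.
apply: le_trans (ler_normB _ _) _; apply: le_trans (lerD hr' hr) _.
by rewrite sE -mulrDl -splitr mulrC.
Qed.

Lemma slope_cst a : has_slope (fun=> a) 0.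
Proof.
move=> e e0; exists 1 => // s _.
by rewrite mulr0 subrr subr0 normr0 mulr_ge0// ltW.
Qed.

Lemma slopeD phi psi l m : has_slope phi l -> has_slope psi m ->
  has_slope (fun s => phi s + psi s) (l + m).
Proof.
move=> h h' e e0.
have e2 : 0 < e / 2 by rewrite divr_gt0.
have [r r0 hr] := h _ e2; have [r' r'0 hr'] := h' _ e2.
exists (Num.min r r'); first by rewrite lt_min r0.
move=> s; rewrite lt_min => /andP[/hr {}hr /hr' {}hr'].
have -> : phi s + psi s - (phi 0 + psi 0) - s * (l + m) =
  (phi s - phi 0 - s * l) + (psi s - psi 0 - s * m) by ring.
apply: le_trans (ler_normD _ _) _; apply: le_trans (lerD hr hr') _.
by rewrite -mulrDl -splitr.
Qed.

Lemma slopeZ a phi l : has_slope phi l -> has_slope (fun s => a * phi s) (a * l).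
Proof.
move=> h e e0; have a1 : 0 < `|a| + 1 by rewrite ltr_wpDl.
have [r r0 hr] := h _ (divr_gt0 e0 a1); exists r => // s /hr {}hr.
have -> : a * phi s - a * phi 0 - s * (a * l) = a * (phi s - phi 0 - s * l) by ring.
rewrite normrM; apply: (@le_trans _ _ ((`|a| + 1) * `|phi s - phi 0 - s * l|)).
  by rewrite ler_wpM2r// lerDl.
apply: le_trans (ler_wpM2l (ltW a1) hr) _.
by rewrite le_eqVlt; apply/orP; left; apply/eqP; field; rewrite gt_eqF.
Qed.

Lemma slope_avg (gT : groupType) (C H : set gT) (phi : gT -> R -> R) (l : gT -> R) :
  cell C H -> (forall g, has_slope (phi g) (l g)) ->
  has_slope (fun s => avg C (fun g => phi g s)) (avg C l).
Proof.
move=> [_ _ fC] h; rewrite /avg; apply: slopeZ.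
rewrite fsum_fset//.
have -> : (fun s => \sum_(g \in C) phi g s) = (fun s => \sum_(g <- fset_set C) phi g s).
  by apply/funext => s; rewrite fsum_fset.
elim: (fset_set C : seq _) => [|x s IH].
  have -> : (fun s : R => \sum_(g <- [::]) phi g s) = fun=> 0.
    by apply/funext => s; rewrite big_nil.
  by rewrite big_nil; exact: slope_cst.
have -> : (fun t : R => \sum_(g <- x :: s) phi g t) =
    fun t => phi x t + \sum_(g <- s) phi g t.
  by apply/funext => t; rewrite big_cons.
by rewrite big_cons; apply: slopeD.
Qed.

Section Frechet.
Context {X : lmodType R}.
Variables (U : set X) (nrm : X -> R).

(** What is needed to restrict derivatives along [U] to lines: linearity of [U] and at most linear
    growth of [nrm] along each ray. *)
Definition normlike := [/\ U 0, forall a h k, U h -> U k -> U (a *: h + k) &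
  forall h, U h -> exists2 M, 0 < M & forall s, 0 <= nrm (s *: h) <= `|s| * M].

Hypothesis nU : normlike.

Lemma normlikeZ a h : U h -> U (a *: h).
Proof. by case: nU => U0 UD _ Uh; rewrite -[_ *: _]addr0; exact: UD. Qed.

Lemma bounded_linear0 l : bounded_linear U nrm l -> l 0 = 0.
Proof.
case: nU => U0 _ _ [lD _]; have := lD (-1) 0 0 U0 U0.
by rewrite scaler0 addr0 mulN1r addNr.
Qed.

Lemma bounded_linearZ l a h : bounded_linear U nrm l -> U h -> l (a *: h) = a * l h.
Proof.
move=> bl Uh; have := bl; case: nU => U0 _ _ [lD _].
by rewrite -[_ *: _]addr0 lD// (bounded_linear0 bl) addr0.
Qed.

Lemma is_D1_slope f x l h : is_D1 U nrm f x l -> U h ->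
  has_slope (fun s => f (x + s *: h)) (l h).
Proof.
move=> [bl hl] Uh e e0; case: (nU) => _ _ /(_ h Uh)[M M0 nM].
have [r r0 hr] := hl (e / M) (divr_gt0 e0 M0).
exists (r / M); first exact: divr_gt0.
move=> s sr; rewrite scale0r addr0 -(bounded_linearZ _ bl)//.
have /andP[_ nMs] := nM s.
have ns : nrm (s *: h) < r by apply: le_lt_trans nMs _; rewrite -ltr_pdivlMr.
apply: le_trans (hr _ (normlikeZ s Uh) ns) _.
apply: le_trans (ler_wpM2l (ltW (divr_gt0 e0 M0)) nMs) _.
by rewrite le_eqVlt; apply/orP; left; apply/eqP; field; rewrite gt_eqF.
Qed.

(** The second conclusion matters because [D1] takes the default value 0 where no derivative exists;
    near [x] this is excluded. *)
Lemma is_D2_slope f x B k h : is_D2 U nrm f x B -> U k -> U h ->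
  has_slope (fun s => D1 U nrm f (x + s *: k) h) (B k h) /\
  exists2 r, 0 < r & forall s, `|s| < r ->
    is_D1 U nrm f (x + s *: k) (D1 U nrm f (x + s *: k)).
Proof.
move=> [[Bl _ _] _ hB] Uk Uh; case: (nU) => U0 _ nn.
have [M M0 nM] := nn k Uk; have [M' M'0 nM'] := nn h Uh.
have BZ s : B (s *: k) h = s * B k h.
  have B0 : B 0 h = 0 by have := Bl (-1) 0 0 h U0 U0 Uh; rewrite scaler0 addr0 mulN1r addNr.
  by have := Bl s k 0 h Uk U0 Uh; rewrite !addr0 B0 addr0.
have small r s : `|s| < r / M -> nrm (s *: k) < r.
  by move=> sr; have /andP[_ nMs] := nM s; apply: le_lt_trans nMs _; rewrite -ltr_pdivlMr.
have /andP[h0 hM] : 0 <= nrm h <= M' by have := nM' 1; rewrite scale1r normr1 mul1r.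
split=> [e e0|]; last first.
  have [r r0 hr] := hB 1 ltr01; exists (r / M); first exact: divr_gt0.
  by move=> s /small sr; case: (hr _ (normlikeZ s Uk) sr).
have MM : 0 < M * M' by rewrite mulr_gt0.
have [r r0 hr] := hB (e / (M * M')) (divr_gt0 e0 MM).
exists (r / M); first exact: divr_gt0.
move=> s sr; have [_ /(_ h Uh)] := hr _ (normlikeZ s Uk) (small _ _ sr).
rewrite BZ scale0r addr0 => /le_trans; apply.
have em : 0 < e / (M * M') by exact: divr_gt0.
have /andP[s0 sM] := nM s.
apply: (@le_trans _ _ (e / (M * M') * (`|s| * M) * M')).
  apply: ler_pM => //; first by rewrite mulr_ge0// ltW.
  by rewrite ler_wpM2l// ltW.
by rewrite le_eqVlt; apply/orP; left; apply/eqP; field; rewrite !gt_eqF.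
Qed.
End Frechet.

Lemma le_sup_norm (I : Type) (d : nat) (z : I -> 'cV[R]_d) M :
  0 <= M -> (forall i, enorm (z i) <= M) -> 0 <= sup_norm z <= M.
Proof.
move=> M0 zM; rewrite /sup_norm; set A := (X in sup X).
have AM x : A x -> 0 <= x <= M by move=> [i _ <-]; rewrite enorm_ge0 zM.
(* The index type may be empty; then the supremum is 0 by convention. *)
have [->|/set0P[x Ax]] := eqVneq A set0; first by rewrite sup0 lexx.
apply/andP; split; last by apply: ge_sup; [exists x|move=> y /AM /andP[]].
have /andP[x0 _] := AM _ Ax; apply: le_trans x0 _.
by apply: ub_le_sup => //; exists M => y /AM /andP[].
Qed.

Lemma normlike_sup_norm (I : Type) (d : nat) (U : set (I -> 'cV[R]_d)) :
  U 0 -> (forall a h k, U h -> U k -> U (a *: h + k)) -> U `<=` @Linfty R d I ->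
  normlike U sup_norm.
Proof.
move=> U0 UD UL; split=> // h /UL[M hM].
exists (`|M| + 1); first by rewrite ltr_wpDl.
move=> s; apply: le_sup_norm => [|i]; first by rewrite mulr_ge0// addr_ge0.
rewrite -[(s *: h) i]/(s *: h i) enormZ ler_wpM2l//.
by apply: le_trans (hM i) _; rewrite ler_wpDr// ler_norm.
Qed.

Lemma normlike_Linfty (I : Type) (d : nat) : normlike (@Linfty R d I) sup_norm.
Proof.
apply: normlike_sup_norm => //.
  by exists 0 => i; rewrite enormE ip0r sqrtr0.
move=> a h k [M hM] [N kN]; exists (`|a| * M + N) => i.
apply: le_trans (enormD _ _) _; rewrite enormZ lerD//.
by rewrite ler_wpM2l.
Qed.

End Slope.

(** * Expansion of the energy *)

Section EnergyExpansion.
Context {R : realType} {d1 d2 : nat}.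
Local Notation d := (d1 + d2)%N.
Variables (G : groupClosed (euclid R d)) (x0 : 'cV[R]_d).
Variables (T : set (elt G)) (C : nat -> set (elt G)).
Implicit Types (g h k : elt G) (u v w : elt G -> 'cV[R]_d) (N : nat).

Local Notation lg g := (lin (val g)).
Local Notation H N := (pow_set T N).

(* All that is used about T^N and C_N in both cases. *)
Definition tame := [/\ forall N, M0 T N -> cell (C N) (H N),
  forall N M, M0 T N -> M0 T M -> exists2 L, M0 T L & H L `<=` H N /\ H L `<=` H M,
  exists N, M0 T N,
  forall N t, M0 T N -> H N t -> lg t = 1%:M
  & finite_set (stab x0 : set (elt G))].

Hypothesis tameT : tame.

Lemma M0_cell N : M0 T N -> cell (C N) (H N). Proof. by case: tameT => h _ _ _ _; exact: h. Qed.
Lemma tame_lin N t : M0 T N -> H N t -> lg t = 1%:M.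
Proof. by case: tameT => _ _ _ h _; exact: h. Qed.
Lemma tame_stab : finite_set (stab x0 : set (elt G)). Proof. by case: tameT. Qed.

Lemma hperiodicS (W : Type) (A B : set (elt G)) (f : elt G -> W) : A `<=` B -> hperiodic B f -> hperiodic A f.
Proof. by move=> AB fB g t /AB; exact: fB. Qed.

Lemma common_period W W' (u : elt G -> W) (v : elt G -> W') : Uper T u -> Uper T v ->
  exists N, [/\ M0 T N, hperiodic (H N) u & hperiodic (H N) v].
Proof.
move=> [N MN uN] [M MM vM]; case: tameT => _ h _ _ _.
by have [L ML [LN LM]] := h N M MN MM; exists L; split=> //; [exact: hperiodicS uN|exact: hperiodicS vM].
Qed.

Lemma periodP W (u : elt G -> W) : Uper T u -> M0 T (period T u) /\ hperiodic (H (period T u)) u.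
Proof.
move=> [N MN uN]; rewrite /period.
by apply: (@xgetPex _ 1%N [set N | M0 T N /\ periodic_mod T N u]); exists N.
Qed.

(** Frees the averages from the arbitrary choice made by [period]. *)
Lemma cell_avgE W (w : elt G -> W) N (f : elt G -> R) : M0 T N -> hperiodic (H N) w ->
  (forall M, M0 T M -> hperiodic (H M) w -> hperiodic (H M) f) ->
  cell_avg C (period T w) f = avg (C N) f.
Proof.
move=> MN wN fper; have [Mp pp] : M0 T (period T w) /\ hperiodic (H (period T w)) w.
  by apply: periodP; exists N.
by apply: (avg_indep (M0_cell Mp) (M0_cell MN)); exact: fper.
Qed.

(** By normality [t] can be moved past [h], so the patch seen from [g] depends only on the coset of
    [g]. *)
Lemma hperiodic_left_mul W (A CA : set (elt G)) (f : elt G -> W) g t : cell CA A -> hperiodic A f -> A t ->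
  (fun h => f (g * t * h)%g) = (fun h => f (g * h)%g).
Proof.
move=> cA fA At; apply/funext => h.
have -> : (g * t * h = g * h * (h^-1 * t * h))%g by rewrite !mulgA mulgK.
by rewrite fA//; exact: normal_conj cA _ _ At.
Qed.

Lemma bar_per (A CA : set (elt G)) u : cell CA A -> hperiodic A u -> hperiodic A (bar x0 u).
Proof.
move=> cA uA g t At; rewrite !(barE tame_stab); congr (_ *: _).
apply: eq_bigr => k _; congr (_ *m _).
exact: (congr1 (fun f => f k) (hperiodic_left_mul g cA uA At)).
Qed.

Lemma Uper_lin a u v : Uper T u -> Uper T v -> Uper T (a *: u + v).
Proof.
move=> uT vT; have [N [MN uN vN]] := common_period uT vT.
by exists N => // g t Ht; rewrite -[LHS]/(a *: u (g * t)%g + v (g * t)%g) uN// vN.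
Qed.

Lemma Uper_cst (c : 'cV[R]_d) : Uper T (fun=> c : 'cV[R]_d).
Proof. by case: tameT => _ _ [N MN] _ _; exists N. Qed.

Lemma Uper_bounded : Uper T `<=` @Linfty R d (elt G).
Proof.
move=> u [N MN uN]; exists (\sum_(g <- fset_set (C N)) enorm (u g)) => g.
have [_ rC fC] := M0_cell MN; have [c [[Cc Hc] _]] := rC g.
have -> : u g = u c by rewrite -(uN c _ Hc) mulVKg.
rewrite (big_fsetD1 c)/= ?in_fset_set ?inE// lerDl.
by rewrite sumr_ge0// => k _; exact: enorm_ge0.
Qed.

Lemma normlike_Uper : normlike (@Uper _ 'cV[R]_d T) sup_norm.
Proof.
by apply: normlike_sup_norm; [exact: Uper_cst|exact: Uper_lin|exact: Uper_bounded].
Qed.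

Section Energy.
Variable V : (cosets_star G x0 -> 'cV[R]_d) -> R.
Implicit Types K : cosets_star G x0.

Definition rep K : elt G := xget 1%g [set k | val K = [set (k * h)%g | h in stab x0]].

Lemma repP K : val K = [set (rep K * h)%g | h in stab x0].
Proof.
rewrite /rep; apply: (@xgetPex _ 1%g [set k | val K = [set (k * h)%g | h in stab x0]]).
by have [] := set_valP K.
Qed.

Definition mean w g : 'cV[R]_d := (cardR (stab x0 : set (elt G)))^-1 *:
  \sum_(h \in stab x0) act (val (g * h)%g) (w (g * h)%g).

Lemma sum_rep K (f : elt G -> 'cV[R]_d) :
  \sum_(h \in val K) f h = \sum_(h \in stab x0) f (rep K * h)%g.
Proof. by rewrite repP fsbig_image// => a b _ _ /mulgI. Qed.

Lemma energy_mean w : energy T C V w =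
  cell_avg C (period T w) (fun g => V (fun K => mean w (g * rep K)%g - mean w g)).
Proof.
apply: (congr1 (cell_avg C (period T w))); apply/funext => g.
apply: (congr1 V).
apply/funext => K; rewrite /mean sum_rep.
by under eq_fsbigr do rewrite mulgA.
Qed.

Lemma mean_expand u g : mean ((fun=> x0) + u) g = act (val g) x0 + lg g *m bar x0 u g.
Proof.
rewrite /mean fsum_fset; last exact: tame_stab.
rewrite big_seq (eq_bigr (fun h => act (val g) x0 + lg g *m (lg h *m u (g * h)%g))); last first.
  move=> h; rewrite in_fset_set ?inE; last exact: tame_stab.
  move=> Sh; rewrite -[((fun=> x0) + u) _]/(x0 + u (g * h)%g) actD (act_stab g Sh).
  by rewrite mulmxA.
rewrite -big_seq big_split/= scalerDr; congr (_ + _); last first.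
  by rewrite (barE tame_stab) -scalemxAr mulmx_sumr.
rewrite big_const_seq count_predT iter_addr addr0 -scaler_nat scalerA.
rewrite cardR_stab mulVf ?scale1r// pnatr_eq0 -lt0n; apply: stab_size.
exact: tame_stab.
Qed.

Definition base_config K : 'cV[R]_d := act (val (rep K)) x0 - x0.

(** The perturbation of the relative positions, rotated back to the frame of [g]. *)
Definition strain u g K : 'cV[R]_d :=
  lg (rep K) *m bar x0 u (g * rep K)%g - bar x0 u g.

Hypothesis V_orth : forall A : 'M[R]_d, orthogonal_mx A -> forall y, V (fun K => A *m y K) = V y.

(** By rotation invariance of [V] the common factor [lg g] can be removed from its arguments, so
    every cell is a perturbation of the same reference [base_config]. *)
Lemma energyE u N : M0 T N -> hperiodic (H N) u ->
  energy T C V ((fun=> x0) + u) = avg (C N) (fun g => V (base_config + strain u g)).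
Proof.
move=> MN uN; rewrite energy_mean.
have -> : (fun g => V (fun K => mean ((fun=> x0) + u) (g * rep K)%g - mean ((fun=> x0) + u) g)) =
   fun g => V (base_config + strain u g).
  apply/funext => g; rewrite -[RHS](V_orth (lin_orth g)); congr V; apply/funext => K.
  rewrite !mean_expand -[(_ + _) K]/(base_config K + strain u g K) /base_config /strain.
  rewrite mulmxDr -actB mulmxBr -act_mul [lg g *m (_ *m _)]mulmxA -linM.
  by apply/matrixP => i j; rewrite !mxE; ring.
apply: cell_avgE => //.
  by move=> g t Ht; rewrite -[LHS]/(x0 + u (g * t)%g) uN.
move=> M MM wM g t Ht; congr V; congr (_ + _); apply/funext => K; rewrite /strain.
have cM := M0_cell MM.
have uM : hperiodic (H M) u.
  by move=> g' t' Ht'; have := wM g' t' Ht'; move=> /addrI.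
have bM := bar_per cM uM.
by rewrite bM// -(congr1 (fun f => f (rep K)) (hperiodic_left_mul g cM bM Ht)).
Qed.

Variable A : set (cosets_star G x0).
Hypotheses (fA : finite_set A) (V_A : forall y, V y = V (patch (fun=> 0) A y)).
Hypothesis V_C2 : frechet_C2 (@Linfty R d _) sup_norm (fun z => V (base_config + z)).

(** Cut off to the interaction range, so that finitely many differences of [bar x0 u] control its
    sup norm. *)
Definition lstrain u g : cosets_star G x0 -> 'cV[R]_d := patch (fun=> 0) A (strain u g).

Lemma strain_lin a u v g : strain (a *: u + v) g = a *: strain u g + strain v g.
Proof.
apply/funext => K; rewrite -[RHS]/(a *: strain u g K + strain v g K) /strain.
rewrite !(bar_lin tame_stab) mulmxDr -scalemxAr scalerBr.
by apply/matrixP => i j; rewrite !mxE; ring.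
Qed.

Lemma lstrain_lin a u v g : lstrain (a *: u + v) g = a *: lstrain u g + lstrain v g.
Proof.
apply/funext => K; rewrite -[RHS]/(a *: lstrain u g K + lstrain v g K) /lstrain strain_lin /patch.
by case: ifP => // _; rewrite scaler0 addr0.
Qed.

Lemma patch_strain u g : V (base_config + strain u g) = V (base_config + lstrain u g).
Proof.
rewrite V_A [RHS]V_A; congr V; apply/funext => K; rewrite /patch.
by case: ifP => // KA; rewrite -[RHS]/(_ + lstrain u g K) /lstrain /patch KA.
Qed.

Definition strain_size u g : R := \sum_(K <- fset_set A) enorm (strain u g K).

Lemma strain_size_ge0 u g : 0 <= strain_size u g.
Proof. by apply: sumr_ge0 => K _; exact: enorm_ge0. Qed.

Lemma lstrain_le u g K : enorm (lstrain u g K) <= strain_size u g.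
Proof.
rewrite /lstrain /patch; case: ifP => [KA|_]; last first.
  by rewrite enormE ip0r sqrtr0 strain_size_ge0.
rewrite /strain_size (big_fsetD1 K)/= ?in_fset_set// lerDl.
by apply: sumr_ge0 => K' _; exact: enorm_ge0.
Qed.

Lemma lstrain_Linfty u g : @Linfty R d _ (lstrain u g).
Proof. by exists (strain_size u g) => K; exact: lstrain_le. Qed.

Local Notation E := (energy T C V).
Local Notation F := (fun z => V (base_config + z)).
Local Notation DF := (D1 (@Linfty R d _) sup_norm F).
Local Notation DE := (D1 (@Uper _ 'cV[R]_d T) sup_norm E).

Lemma DF_spec z : @Linfty R d _ z -> is_D1 (@Linfty R d _) sup_norm F z (DF z).
Proof. by move=> /V_C2[[_ h _] _]. Qed.

(** A derivative that exists is determined by its slopes along lines, and the slope of a finite mean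
    is the mean of the slopes supplied by [V]. *)
Lemma energyD1 u v N : M0 T N -> hperiodic (H N) u -> hperiodic (H N) v ->
  is_D1 (@Uper _ 'cV[R]_d T) sup_norm E ((fun=> x0) + u) (DE ((fun=> x0) + u)) ->
  DE ((fun=> x0) + u) v = avg (C N) (fun g => DF (lstrain u g) (lstrain v g)).
Proof.
move=> MN uN vN D1u.
have vU : Uper T v by exists N.
have := is_D1_slope normlike_Uper D1u vU.
move=> /slope_unique; apply.
have -> : (fun s => E ((fun=> x0) + u + s *: v)) =
    fun s => avg (C N) (fun g => F (lstrain u g + s *: lstrain v g)).
  apply/funext => s; rewrite -addrA [u + _]addrC (energyE MN); last first.
    by move=> g t Ht; rewrite -[LHS]/(s *: v (g * t)%g + u (g * t)%g) uN// vN.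
  by congr avg; apply/funext => g; rewrite patch_strain lstrain_lin [_ + lstrain u g]addrC.
apply: (slope_avg (phi := fun g s => F (lstrain u g + s *: lstrain v g))
  (l := fun g => DF (lstrain u g) (lstrain v g)) (M0_cell MN)) => g.
exact: (is_D1_slope (normlike_Linfty _ _) (DF_spec (lstrain_Linfty u g)) (lstrain_Linfty v g)).
Qed.

Lemma energyD2 B u v N : M0 T N -> hperiodic (H N) u -> hperiodic (H N) v ->
  is_D2 (@Uper _ 'cV[R]_d T) sup_norm E (fun=> x0) B ->
  B u v = avg (C N) (fun g => V2 V base_config (lstrain u g) (lstrain v g)).
Proof.
move=> MN uN vN D2B.
have uU : Uper T u by exists N.
have vU : Uper T v by exists N.
have [/slope_unique h [r r0 hr]] := is_D2_slope normlike_Uper D2B uU vU.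
apply: h.
(* The formula for the first derivative is available only for small [s], where the derivative
   exists; this suffices for a slope at 0. *)
apply: (@eq_slope _ (fun s => avg (C N) (fun g => DF (0 + s *: lstrain u g) (lstrain v g)))).
  exists r => // s /hr D1s; rewrite (energyD1 MN _ vN D1s); last first.
    by move=> g t Ht; rewrite -[LHS]/(s *: u (g * t)%g) uN.
  congr avg; apply/funext => g; congr (DF _ _).
  have := lstrain_lin s u 0 g; rewrite addr0 => ->; rewrite add0r.
  have -> : lstrain 0 g = 0; last by rewrite addr0.
  have := lstrain_lin (-1) 0 0 g; rewrite scaler0 addr0 scaleN1r addNr => <-.
  by [].
apply: (slope_avg (phi := fun g s => DF (0 + s *: lstrain u g) (lstrain v g))
  (l := fun g => V2 V base_config (lstrain u g) (lstrain v g)) (M0_cell MN)) => g.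
have L0 : @Linfty R d (cosets_star G x0) 0.
  by case: (normlike_Linfty (R := R) (cosets_star G x0) d).
have [D20 _] := V_C2 L0.
exact: (is_D2_slope (normlike_Linfty _ _) D20 (lstrain_Linfty u g) (lstrain_Linfty v g)).1.
Qed.

(** In every cell the second derivative of [V] is taken at the same [base_config], so one constant
    works for all periods. *)
Lemma energyD2_le B : is_D2 (@Uper _ 'cV[R]_d T) sup_norm E (fun=> x0) B ->
  exists2 c, 0 <= c & forall u v N, M0 T N -> hperiodic (H N) u -> hperiodic (H N) v ->
    `|B u v| <= c * avg (C N) (fun g => strain_size u g * strain_size v g).
Proof.
move=> D2B.
have L0 : @Linfty R d (cosets_star G x0) 0.
  by case: (normlike_Linfty (R := R) (cosets_star G x0) d).
have [[[_ _ [c hc]] _ _] _] := V_C2 L0.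
exists `|c| => // u v N MN uN vN.
rewrite (energyD2 MN uN vN D2B) -(avgZ (M0_cell MN)).
apply: le_trans (avg_abs (M0_cell MN) _) _; apply: (le_avg (M0_cell MN)) => g.
apply: le_trans (hc _ _ (lstrain_Linfty u g) (lstrain_Linfty v g)) _.
have /andP[u0 uM] := le_sup_norm (strain_size_ge0 u g) (lstrain_le u g).
have /andP[v0 vM] := le_sup_norm (strain_size_ge0 v g) (lstrain_le v g).
rewrite mulrA; apply: le_trans (ler_wpM2r v0 (ler_wpM2r u0 (ler_norm c))) _.
by apply: ler_pM => //; [exact: mulr_ge0|exact: ler_wpM2l].
Qed.

End Energy.
End EnergyExpansion.

(** * Boundedness and stability constants *)

Section Stability.
Context {R : realType} {d1 d2 : nat}.
Local Notation d := (d1 + d2)%N.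
Variables (G : groupClosed (euclid R d)) (x0 : 'cV[R]_d).
Variables (T : set (elt G)) (C : nat -> set (elt G)) (P : set (elt G)).
Variable V : (cosets_star G x0 -> 'cV[R]_d) -> R.
Variable Sk : set 'M[R]_d.
Implicit Types (g h k : elt G) (u v w : elt G -> 'cV[R]_d) (N : nat) (D : patches x0 P).

Local Notation lg g := (lin (val g)).
Local Notation H N := (pow_set T N).

Hypotheses (tameT : tame x0 T C) (adP : admissible x0 P).
Hypotheses (Sk0 : Sk 0) (SkL : forall a A B, Sk A -> Sk B -> Sk (a *: A + B)).
Hypothesis SkS : Sk `<=` Skew.

Let fin_stab := tame_stab tameT.

Lemma admissible1 : P 1%g.
Proof.
have [_ _ [A' [A'' [AP hAB _ _]]]] := adP.
have [hA hB] : A' 1%g /\ A'' 1%g by [].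
by apply: AP; exists 1%g => //; exists 1%g => //; rewrite mulg1.
Qed.

Let P1 := admissible1.
Let fP : finite_set P. Proof. by case: adP. Qed.
Let PS : mul_set P (stab x0) = P. Proof. by case: adP. Qed.

Definition deviation u g : R := defect x0 P Sk (fun h => u (g * h)%g).

Lemma deviation_ge0 u g : 0 <= deviation u g.
Proof. exact: defect_ge0. Qed.

Lemma deviation_per N u : M0 T N -> hperiodic (H N) u -> hperiodic (H N) (deviation u).
Proof.
by move=> MN uN g t Ht; rewrite /deviation (hperiodic_left_mul g (M0_cell tameT MN) uN Ht).
Qed.

Local Notation norm := (seminorm x0 T C P Sk).

Lemma seminorm_sqr N u : M0 T N -> hperiodic (H N) u ->
  norm u ^+ 2 = avg (C N) (deviation u).
Proof.
move=> MN uN.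
have e : cell_avg C (period T u) (deviation u) = avg (C N) (deviation u).
  by apply: (cell_avgE tameT MN uN) => M MM uM; exact: deviation_per.
rewrite /seminorm sqr_sqrtr//.
have -> : 0 <= cell_avg C (period T u) (deviation u); last by [].
by rewrite e (avg_ge0 (M0_cell tameT MN))// => g; exact: deviation_ge0.
Qed.

Lemma seminorm_ge0 u : 0 <= norm u.
Proof. exact: sqrtr_ge0. Qed.

Lemma patches_of N u : M0 T N -> hperiodic (H N) u ->
  exists D, [/\ cellC D = C N, cellH D = H N, field D = bar x0 u & dev D = deviation u].
Proof.
move=> MN uN; have cN := M0_cell tameT MN.
pose r g := sval (rigid_approx fin_stab fP PS Sk0 SkL (fun h => u (g * h)%g)).
have rP g : Sk (r g).2 /\ forall k, P k ->
    nsq (lg k *m bar x0 u (g * k)%g - (r g).1 - (r g).2 *m (act (val k) x0 - x0)) <= deviation u g.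
  have := svalP (rigid_approx fin_stab fP PS Sk0 SkL (fun h => u (g * h)%g)).
  move=> [h1 h2]; split=> // k Pk; have := h2 k Pk.
  by rewrite (bar_shift fin_stab).
have r_per : hperiodic (H N) r by move=> g t Ht; rewrite /r (hperiodic_left_mul g cN uN Ht).
have r1_per : hperiodic (H N) (fun g => (r g).1) by move=> g t Ht; rewrite r_per.
have r2_per : hperiodic (H N) (fun g => (r g).2) by move=> g t Ht; rewrite r_per.
by exists (Patches cN (bar_per tameT cN uN) r1_per r2_per (deviation_per MN uN)
  (fun t => tame_lin tameT MN) (fun g => SkS (rP g).1) (fun g => (rP g).2)).
Qed.

(** The shift cancels in a strain but the spin does not, which is why a bound on the spin is
    required below. *)
Lemma strain_gap (K : cosets_star G x0) u D g : field D = bar x0 u ->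
  strain u g K = gap (rep K) D g - gap 1%g D g + spin D g *m (act (val (rep K)) x0 - x0).
Proof.
move=> Du; rewrite /strain -Du.
have -> : field D g = gap 1%g D g + pshift D g.
  by rewrite /gap act_one subrr mulmx0 subr0 mulg1 -[lg 1%g]/(1%:M : 'M[R]_d) mul1mx subrK.
by rewrite /gap; apply/matrixP => i j; rewrite !mxE; ring.
Qed.

Section Bounded.
Variable A : set (cosets_star G x0).
Hypothesis spinP : forall w : 'cV[R]_d, msdom (fun D g => spin D g *m w).

Lemma strain_size_le : exists2 c, 0 <= c & forall N u, M0 T N -> hperiodic (H N) u ->
  avg (C N) (fun g => strain_size A u g ^+ 2) <= c * norm u ^+ 2.
Proof.
pose F (K : cosets_star G x0) D g :=
  gap (rep K) D g - gap 1%g D g + spin D g *m (act (val (rep K)) x0 - x0).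
have FK K : msdom (F K).
  by apply: msdomD => //; apply: msdomB; exact: gap_msdom.
have [c c0 hc] : dominated (fun D g => (\sum_(K <- fset_set A) enorm (F K D g)) ^+ 2).
  elim: (fset_set A : seq _) => [|K s IH].
    apply: (@le_dominated _ _ _ G x0 P _ (fun _ _ => 0)); last exact: dominated0.
    by move=> D g; rewrite big_nil expr0n.
  apply: le_dominated (dominatedZ (ler0n R 2) (dominatedD (FK K) IH)) => D g.
  rewrite big_cons -sqr_enorm; set x := enorm _; set y := \sum_(_ <- _) _.
  by have := sqr_ge0 (x - y); nra.
exists c => // N u MN uN; have [D [DC DH Du Dd]] := patches_of MN uN.
rewrite (seminorm_sqr MN uN) -DC -Dd; apply: le_trans (hc D).
apply: (le_avg (patches_cell D)) => g; rewrite le_eqVlt; apply/orP; left; apply/eqP.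
by congr (_ ^+ 2); apply: eq_bigr => K _; rewrite (strain_gap K g Du).
Qed.

Hypotheses (fA : finite_set A) (V_A : forall y, V y = V (patch (fun=> 0) A y)).
Hypothesis V_orth : forall A : 'M[R]_d, orthogonal_mx A -> forall y, V (fun K => A *m y K) = V y.
Hypothesis V_C2 : frechet_C2 (@Linfty R d _) sup_norm (fun z => V (@base_config _ _ _ G x0 + z)).

Lemma energy2_cases (B := energy2 T C V) :
  is_D2 (@Uper _ 'cV[R]_d T) sup_norm (energy T C V) (fun=> x0) B \/ B = fun _ _ => 0.
Proof.
rewrite /B /energy2 /D2.
set S := [set B | _]; have [[B' SB']|nS] := pselect (exists B, S B).
  by left; apply: (@xgetPex _ _ S); exists B'.
by right; rewrite xgetPN// => B' SB'; apply: nS; exists B'.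
Qed.

Lemma energy2_bounded : bounded_wrt (Uper T) norm (energy2 T C V).
Proof.
have [D2B|->] := energy2_cases; last first.
  by exists 1 => // u v _ _; rewrite normr0 !mulr_ge0// seminorm_ge0.
have [c c0 hc] := energyD2_le tameT V_orth fA V_A V_C2 D2B.
have [c' c'0 hc'] := strain_size_le.
exists (c * c' + 1); first by rewrite ltr_wpDl// mulr_ge0.
move=> u v uU vU; have [N [MN uN vN]] := common_period tameT uU vU.
apply: le_trans (hc u v N MN uN vN) _.
have n0 : 0 <= norm u * norm v by rewrite mulr_ge0// seminorm_ge0.
(* By Cauchy-Schwarz for means this reduces to the mean square bound [strain_size_le]. *)
suff h : avg (C N) (fun g => strain_size A u g * strain_size A v g) <= c' * (norm u * norm v).
  rewrite -mulrA; apply: le_trans (ler_wpM2l c0 h) _.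
  by rewrite [leLHS]mulrA ler_wpM2r// lerDl.
have cN := M0_cell tameT MN.
have a0 : 0 <= avg (C N) (fun g => strain_size A u g * strain_size A v g).
  by apply: (avg_ge0 cN) => g; rewrite mulr_ge0// strain_size_ge0.
have b0 : 0 <= c' * (norm u * norm v) by rewrite mulr_ge0.
rewrite -ler_sqr ?nnegrE ?a0 ?b0//.
apply: le_trans (avg_CS cN _ _) _; rewrite !exprMn [c' ^+ 2]expr2 [leRHS]mulrACA.
apply: ler_pM; try by apply: (avg_ge0 cN) => g; exact: sqr_ge0.
  exact: hc'.
exact: hc'.
Qed.
End Bounded.

(** If [P] fixed [x0], so would [A'']; then the affine hull of the orbit would be a single point. *)
Lemma moving_patch : orbit_of G x0 setT <> [set x0] -> exists2 k, P k & act (val k) x0 <> x0.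
Proof.
move=> orb; have [_ _ [A' [A'' [AP hAB _ aE]]]] := adP.
have [hA hB] : A' 1%g /\ A'' 1%g by [].
apply: contrapT => h; apply: orb.
have A''x k : A'' k -> act (val k) x0 = x0.
  by move=> Ak; apply: contrapT => kx; apply: h; exists k => //; apply: AP; exists 1%g => //; exists k => //; rewrite mul1g.
apply/seteqP; split=> [_ [k _ <-]|_ ->]; last by exists 1%g => //; exact: act_one.
have [n [c [r [rA e]]]] := orbit_aff k aE.
apply/eqP; rewrite -subr_eq0 e big1// => i _.
by rewrite A''x// subrr scaler0.
Qed.

(* The test function stretches the orbit: U g = k x0 - x0 on the orbit point k
   x0 modulo T^N, and 0 elsewhere; no skew matrix S satisfies S v = v. *)
Lemma seminorm_neq0 k N : P k -> act (val k) x0 <> x0 -> M0 T N ->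
  (forall t, H N t -> act (val t) x0 <> act (val k) x0) ->
  exists2 u, Uper T u & norm u <> 0.
Proof.
move=> Pk kx MN kT; have cN := M0_cell tameT MN.
(* Decides whether [g x0] lies on the orbit of [k x0] under [H N]. *)
pose c g := `[< exists2 t, H N t & act (val g) x0 = act (val (t * k)%g) x0 >].
pose v := act (val k) x0 - x0.
pose u g := (lg g)^T *m (if c g then v else 0).
have cc g g' t : H N t -> act (val g') x0 = act (val (t * g)%g) x0 -> c g -> c g'.
  move=> Ht e /asboolP[t' Ht' e']; apply/asboolP; exists (t * t')%g; first exact: normal_mul cN _ _ Ht Ht'.
  by rewrite e !act_mul e' act_mul.
have H1 : H N 1%g by have := normal_mul cN; case: cN => -[[+ _] _] _ _ _; rewrite inE.
have ceq g g' t : H N t -> act (val g') x0 = act (val (t * g)%g) x0 -> c g = c g'.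
  move=> Ht e; apply/idP/idP; first exact: cc Ht e.
  apply: (cc _ _ t^-1%g); first exact: normal_inv cN _ Ht.
  by rewrite act_mul e -act_mul mulKg.
have uN : hperiodic (H N) u.
  move=> g t Ht; rewrite /u linM (tame_lin tameT MN Ht) mulmx1.
  rewrite -(ceq g (g * t)%g (g * t * g^-1)%g) ?mulgVK//.
  by have := normal_conj cN g^-1%g Ht; rewrite invgK.
have uU : Uper T u by exists N.
exists u => // nu0.
have ub g : bar x0 u g = u g.
  apply: bar_fixed => // h Sh.
  rewrite /u linM trmx_mul !mulmxA linVK mul1mx (ceq g (g * h)%g 1%g)// mul1g.
  exact: act_stab.
(* A nonnegative function with vanishing mean vanishes at the identity, so the test function would
   be rigid on [P]. *)
have : deviation u 1%g <= 0.
  have := le_term_avg cN 1%g (deviation_per MN uN) (deviation_ge0 u).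
  by rewrite -(seminorm_sqr MN uN) nu0 expr0n mulr0.
move=> /(defect0 fin_stab fP Sk0 SkL)[_ [a [S [SS h]]]].
have {}h g : P g -> (if c g then v else 0) = a + S *m (act (val g) x0 - x0).
  move=> Pg; rewrite -h// (bar_patch fin_stab PS)//.
  have -> : (fun h => u (1 * h)%g) = u by apply/funext => g'; rewrite mul1g.
  by rewrite ub /u mulmxA linVK mul1mx.
have c1 : c 1%g = false.
  apply/negP => /asboolP[t Ht e]; apply: (kT t^-1%g); first exact: normal_inv cN _ Ht.
  by have := congr1 (act (val t^-1%g)) e; rewrite -!act_mul mulg1 mulKg.
have ck : c k by apply/asboolP; exists 1%g; rewrite ?mul1g.
have := h _ P1; rewrite c1 act_one subrr mulmx0 addr0 => a0.
have := h _ Pk; rewrite ck -a0 add0r -/v => vS.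
have : nsq v = 0 by rewrite {2}vS skew_ip//; exact: SkS.
by move=> v0; apply: kx; apply/eqP; rewrite -subr_eq0; apply/eqP/nsq_eq0; rewrite -/v v0.
Qed.

(** Boundedness makes [- c] admissible in the supremum, and the Rayleigh quotient of one
    displacement with nonzero seminorm bounds it from above. *)
Lemma stability_fin_num : bounded_wrt (Uper T) norm (energy2 T C V) ->
  (exists2 u, Uper T u & norm u <> 0) ->
  stability_constant T C V P Sk \is a fin_num.
Proof.
move=> [c c0 hc] [u uU /eqP nu]; rewrite /stability_constant.
set S := [set c | _]; apply/fin_real.
have nu2 : 0 < norm u ^+ 2 by rewrite exprn_even_gt0.
apply/andP; split.
  apply: (@lt_le_trans _ _ (- c)%:E); first exact: ltNyr.
  apply: ereal_sup_ubound; exists (- c) => // v vU.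
  have := hc v v vU vU; rewrite ler_norml => /andP[+ _].
  by rewrite expr2 mulNr mulrA.
apply: (@le_lt_trans _ _ (energy2 T C V u u / norm u ^+ 2)%:E); last exact: ltry.
apply: ge_ereal_sup => _ [x Sx <-]; rewrite lee_fin ler_pdivlMr//.
exact: Sx.
Qed.

End Stability.

(** * Rotational invariance *)

Section Cayley.
Context {R : realType} {n : nat}.
Implicit Types (S : 'M[R]_n).

Lemma nsq_cayley S (x : 'cV[R]_n) : Skew S -> nsq x <= nsq ((1%:M - S) *m x).
Proof.
move=> SS; rewrite mulmxBl mul1mx nsq_sub skew_ip// mulr0 subr0 lerDl.
exact: nsq_ge0.
Qed.

Lemma unit_cayley S : Skew S -> 1%:M - S \in unitmx.
Proof.
move=> SS; rewrite -row_free_unit; apply: inj_row_free => v v0.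
apply: trmx_inj; rewrite trmx0; apply: nsq_eq0.
have SN : Skew (- S) by rewrite /Skew/= linearN/= SS.
apply: le_trans (nsq_cayley _ SN) _.
have -> : (1%:M - - S) *m v^T = 0; last by rewrite ip0r.
by rewrite -(SS : _^T = _) -[X in X - _]trmx1 -linearB/= -trmx_mul v0 trmx0.
Qed.

(** [Q t] is the Cayley transform, the product of the inverse of [1 - t S] with [1 + t S]. The
    remainder [M t] is bounded uniformly in [t] because the inverse of [1 - t S] does not increase
    the norm. *)
Lemma cayley S : Skew S -> exists Q M : R -> 'M[R]_n,
  [/\ forall t, orthogonal_mx (Q t),
      forall t, Q t - 1%:M = t *: (2 *: S + t *: M t)
    & exists m, forall t (x : 'cV[R]_n), enorm (M t *m x) <= m * enorm x].
Proof.
move=> SS.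
have SkZ t : Skew (t *: S) by rewrite /Skew/= linearZ/= SS scalerN.
pose A t := 1%:M - t *: S.
have uA t : A t \in unitmx by apply: unit_cayley.
have AT t : (A t)^T = A (- t).
  by rewrite /A linearB/= trmx1 linearZ/= SS scalerN scaleNr opprK.
have AC t : A t *m A (- t) = A (- t) *m A t.
  rewrite /A !mulmxBl !mulmxBr !mul1mx !mulmx1 -!scalemxAl -!scalemxAr.
  by apply/matrixP => i j; rewrite !mxE; ring.
exists (fun t => invmx (A t) *m A (- t)), (fun t => invmx (A t) *m (2 *: (S *m S))); split.
- move=> t; apply/eqP; rewrite trmx_mul trmx_inv !AT opprK -mulmxA.
  have -> : invmx (A t) *m A (- t) = A (- t) *m invmx (A t).
    by rewrite -{1}(mulmxK (uA t) (A (- t))) -AC -!mulmxA mulKmx.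
  by rewrite mulKmx// mulmxV.
- move=> t; apply: (can_inj (mulKmx (uA t))).
  rewrite mulmxBr mulmx1 mulKVmx// -scalemxAr mulmxDr -[A t *m (t *: _)]scalemxAr mulKVmx//.
  rewrite /A scaleNr opprK -scalemxAr mulmxBl mul1mx -scalemxAl.
  by apply/matrixP => i j; rewrite !mxE; ring.
- exists (enorm (2 *: (S *m S))) => t x.
  rewrite -(mulmxA (invmx _)); apply: le_trans _ (enorm_mul _ _).
  rewrite -ler_sqr ?nnegrE ?enorm_ge0// !sqr_enorm.
  apply: le_trans (nsq_cayley _ (SkZ t)) _.
  by rewrite -/(A t) (mulKVmx (uA t)).
Qed.
End Cayley.

(** * Derivatives along curves with quadratic remainder *)

Section CurveSlope.
Context {R : realType} {I : Type} {d : nat}.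
Variable U : set (I -> 'cV[R]_d).
Hypotheses (nU : normlike U sup_norm).

Lemma curve_slope f x l h (r : R -> I -> 'cV[R]_d) M :
  is_D1 U sup_norm f x l -> U h -> (forall t, U (r t)) ->
  (forall i, enorm (h i) <= M) -> (forall t i, enorm (r t i) <= M) ->
  has_slope (fun t => f (x + t *: (h + t *: r t))) (l h).
Proof.
move=> [bl hl] Uh Ur hM rM e e0.
have [lD [c hc]] := bl.
pose m := `|M| + 1; have m0 : 0 < m by rewrite ltr_wpDl.
have Mm : M <= m by rewrite /m ler_wpDr// ler_norm.
pose c' := `|c| + 1; have c'0 : 0 < c' by rewrite ltr_wpDl.
have e1 : 0 < e / (4 * m) by rewrite divr_gt0// mulr_gt0.
have [q q0 hq] := hl _ e1.
(* The first bound gives [h + t *: r t] norm at most [2 * m], the second puts the increment within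
   radius [q], and the third makes the quadratic term at most [e / 2 * |t|]. *)
exists (Num.min 1 (Num.min (q / (2 * m)) (e / (2 * (c' * m))))).
  by rewrite !lt_min ltr01 !divr_gt0// !mulr_gt0.
move=> t; rewrite !lt_min => /and3P[t1 tq te].
rewrite scale0r addr0.
set k := t *: _.
have kE : k = t *: h + (t ^+ 2) *: r t by rewrite /k scalerDr scalerA expr2.
have Uk : U k.
  by rewrite /k; apply: normlikeZ nU _ _ _; rewrite addrC; case: nU => _ UD _; exact: UD.
have /andP[k0 kM] : 0 <= sup_norm k <= `|t| * (2 * m).
  apply: le_sup_norm => [|i]; first by rewrite !mulr_ge0// ltW.
  rewrite /k -[X in enorm X]/(t *: (h i + t *: r t i)) enormZ ler_wpM2l//.
  apply: le_trans (enormD _ _) _; rewrite enormZ mulr_natl mulr2n lerD//.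
    exact: le_trans (hM i) Mm.
  apply: le_trans (ler_pM _ _ (ltW t1) (rM t i)) _; rewrite ?mul1r//.
  exact: enorm_ge0.
have rc : `|l (r t)| <= c' * m.
  apply: le_trans (hc _ (Ur t)) _.
  have /andP[r0 rm] : 0 <= sup_norm (r t) <= m.
    by apply: le_sup_norm => [|i]; [exact: ltW|exact: le_trans (rM t i) Mm].
  apply: (@le_trans _ _ (c' * sup_norm (r t))); last by rewrite ler_wpM2l// ltW.
  by rewrite ler_wpM2r// /c' ler_wpDr// ler_norm.
have lk : l k = t * l h + t ^+ 2 * l (r t).
  rewrite kE lD//; last exact: normlikeZ nU _ _ (Ur t).
  by rewrite (bounded_linearZ nU _ bl).
have -> : f (x + k) - f x - t * l h = (f (x + k) - f x - l k) + t ^+ 2 * l (r t).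
  by rewrite lk; ring.
apply: le_trans (ler_normD _ _) _.
have b1 : `|f (x + k) - f x - l k| <= e / 2 * `|t|.
  apply: le_trans (hq _ Uk _) _.
    by apply: le_lt_trans kM _; rewrite -ltr_pdivlMr// mulr_gt0.
  apply: le_trans (ler_wpM2l (ltW e1) kM) _.
  by rewrite le_eqVlt; apply/orP; left; apply/eqP; field; rewrite gt_eqF.
have b2 : `|t ^+ 2 * l (r t)| <= e / 2 * `|t|.
  have -> : `|t ^+ 2 * l (r t)| = `|t| * `|l (r t)| * `|t| by rewrite normrM normrX; ring.
  rewrite ler_wpM2r//; apply: le_trans (ler_wpM2l (normr_ge0 t) rc) _.
  move: te; rewrite ltr_pdivlMr ?mulr_gt0// => /ltW te.
  by rewrite ler_pdivlMr//; apply: le_trans te; rewrite le_eqVlt; apply/orP; left; apply/eqP; ring.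
by apply: le_trans (lerD b1 b2) _; rewrite -mulrDl -splitr.
Qed.
End CurveSlope.

(** * Finite groups: invariance of the energy and its second derivative *)

Section FiniteGroup.
Context {R : realType} {d1 d2 : nat}.
Local Notation d := (d1 + d2)%N.
Variables (G : groupClosed (euclid R d)) (x0 : 'cV[R]_d).
Variables (T : set (elt G)) (C : nat -> set (elt G)).
Variable V : (cosets_star G x0 -> 'cV[R]_d) -> R.
Implicit Types (g h k : elt G) (u v w n : elt G -> 'cV[R]_d) (N : nat).

Local Notation lg g := (lin (val g)).
Local Notation H N := (pow_set T N).
Local Notation U := (@Uper _ 'cV[R]_d T).
Local Notation E := (energy T C V).
Local Notation DE := (D1 U sup_norm E).
Local Notation cst0 := ((fun=> x0) : elt G -> 'cV[R]_d).

Hypothesis tameT : tame x0 T C.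
Hypothesis H1 : forall N t, M0 T N -> H N t -> t = 1%g.
Hypothesis V_orth : forall A : 'M[R]_d, orthogonal_mx A -> forall y, V (fun K => A *m y K) = V y.

Let fin_stab := tame_stab tameT.
Let nU := normlike_Uper tameT.

Lemma hperiodic_trivial N (W : Type) (u : elt G -> W) : M0 T N -> hperiodic (H N) u.
Proof. by move=> MN g t /(H1 MN) ->; rewrite mulg1. Qed.

Lemma Uper_trivial u : U u.
Proof. by have [_ _ [N MN] _ _] := tameT; exists N => //; exact: hperiodic_trivial. Qed.

Lemma cell_trivial N : M0 T N -> C N = setT.
Proof.
move=> MN; have [_ rC _] := M0_cell tameT MN.
apply/seteqP; split=> // g _; have [c [[Cc /(H1 MN) e] _]] := rC g.
by have -> : g = c by rewrite -(mulVKg c g) e mulg1.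
Qed.

Lemma energy_trivial w : E w =
  avg setT (fun g => V (fun K => mean x0 w (g * rep K)%g - mean x0 w g)).
Proof.
rewrite energy_mean /cell_avg cell_trivial//.
by have [] := periodP (Uper_trivial w).
Qed.

Lemma mean_add w n g : mean x0 (w + n) g = mean x0 w g + lg g *m bar x0 n g.
Proof.
have e v : v = cst0 + (v - cst0) by rewrite addrC subrK.
rewrite (e (w + n)) (mean_expand tameT) [in RHS](e w) (mean_expand tameT) -[RHS]addrA -mulmxDr.
congr (_ + _ *m _); rewrite addrAC.
by have := bar_lin fin_stab 1 (w - cst0) n g; rewrite !scale1r.
Qed.

(** Such an [n] translates all means by the same vector, and [V] sees only their differences. *)
Lemma energy_null w n (a : 'cV[R]_d) : (forall g, lg g *m bar x0 n g = a) -> E (w + n) = E w.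
Proof.
move=> na; rewrite !energy_trivial; congr avg; apply/funext => g; congr V.
by apply/funext => K; rewrite !mean_add !na; apply/matrixP => i j; rewrite !mxE; ring.
Qed.

(** Written so that the deformed positions [act (val g) (w g)] are multiplied by [Q]. *)
Definition rotate (Q : 'M[R]_d) w : elt G -> 'cV[R]_d :=
  fun g => w g + (lg g)^T *m ((Q - 1%:M) *m act (val g) (w g)).

Lemma energy_rotate Q w : orthogonal_mx Q -> E (rotate Q w) = E w.
Proof.
move=> oQ; have mQ g : mean x0 (rotate Q w) g = Q *m mean x0 w g.
  rewrite /mean -scalemxAr !fsum_fset// mulmx_sumr; congr (_ *: _).
  apply: eq_bigr => h _; rewrite /rotate actD mulmxA linVK mul1mx mulmxBl mul1mx.
  by rewrite addrC subrK.
rewrite !energy_trivial; congr avg; apply/funext => g.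
rewrite -[RHS](V_orth oQ); congr V; apply/funext => K.
by rewrite !mQ mulmxBr.
Qed.

Definition spin_field (S : 'M[R]_d) w : elt G -> 'cV[R]_d :=
  fun g => (lg g)^T *m (S *m act (val g) (w g)).

(* The curve t |-> rotate (Q t) w, with Q the Cayley transform, has velocity 2
   spin_field S w at t = 0. *)
Lemma rotation_curve S w : Skew S -> exists Q r M,
  [/\ forall t, orthogonal_mx (Q t),
      forall t, rotate (Q t) w = w + t *: ((2 *: spin_field S w) + t *: r t),
      forall g, enorm ((2 *: spin_field S w) g) <= M
    & forall t g, enorm (r t g) <= M].
Proof.
move=> SS; have [Q [M [oQ QE [m hm]]]] := cayley SS.
pose r t g := (lg g)^T *m (M t *m act (val g) (w g)).
have [a ha] := Uper_bounded tameT (Uper_trivial (2 *: spin_field S w)).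
have [b hb] := Uper_bounded tameT (Uper_trivial (fun g => act (val g) (w g))).
exists Q, r, (Num.max a (`|m| * b)); split=> //.
- move=> t; apply/funext => g; rewrite /rotate QE; congr (_ + _).
  rewrite -[RHS]/(t *: (2 *: spin_field S w g + t *: r t g)) /r /spin_field.
  by rewrite -scalemxAl mulmxDl -!scalemxAl -scalemxAr mulmxDr -!scalemxAr.
- by move=> g; rewrite le_max ha.
- move=> t g; rewrite le_max; apply/orP; right; rewrite /r enorm_orth; last exact: trlin_orth.
  apply: le_trans (hm _ _) _; apply: (@le_trans _ _ (`|m| * enorm (act (val g) (w g)))).
    by rewrite ler_wpM2r ?enorm_ge0// ler_norm.
  by rewrite ler_wpM2l.
Qed.

Lemma D1_null w n (a : 'cV[R]_d) : is_D1 U sup_norm E w (DE w) ->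
  (forall g, lg g *m bar x0 n g = a) -> DE w n = 0.
Proof.
move=> Dw na; apply: slope_unique (is_D1_slope nU Dw (Uper_trivial n)) _.
have -> : (fun s => E (w + s *: n)) = fun=> E w; last exact: slope_cst.
apply/funext => s; apply: (@energy_null _ _ (s *: a)) => g.
have := bar_lin fin_stab s n 0 g; rewrite bar0// !addr0 => ->.
by rewrite -scalemxAr na.
Qed.

(** The energy is constant along the rotation curve, so its slope in the direction of the velocity
    is 0. *)
Lemma D1_spin w S : Skew S -> is_D1 U sup_norm E w (DE w) -> DE w (spin_field S w) = 0.
Proof.
move=> SS Dw; have [Q [r [M [oQ QE hM rM]]]] := rotation_curve w SS.
have := curve_slope nU Dw (Uper_trivial _) (fun t => Uper_trivial (r t)) hM rM.
under [X in has_slope X]funext do rewrite -QE energy_rotate//.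
move=> /slope_unique/(_ (slope_cst _)).
rewrite (bounded_linearZ nU _ Dw.1 (Uper_trivial _)) => /eqP.
by rewrite mulf_eq0 pnatr_eq0/= => /eqP.
Qed.

Section SecondDerivative.
Variable B : (elt G -> 'cV[R]_d) -> (elt G -> 'cV[R]_d) -> R.
Hypothesis D2B : is_D2 U sup_norm E cst0 B.
Hypothesis E1 : forall u, DE cst0 u = 0.

Let D10 : is_D1 U sup_norm E cst0 (DE cst0). Proof. by case: D2B. Qed.

Lemma B_slope u v : has_slope (fun s => DE (cst0 + s *: u) v) (B u v).
Proof. by have [] := is_D2_slope nU D2B (Uper_trivial u) (Uper_trivial v). Qed.

Lemma D1_near u : exists2 r, 0 < r & forall s, `|s| < r ->
  is_D1 U sup_norm E (cst0 + s *: u) (DE (cst0 + s *: u)).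
Proof. by have [] := is_D2_slope nU D2B (Uper_trivial u) (Uper_trivial u). Qed.

Lemma B_null_r u n (a : 'cV[R]_d) : (forall g, lg g *m bar x0 n g = a) -> B u n = 0.
Proof.
move=> na; apply: slope_unique (B_slope u n) _.
apply: eq_slope (slope_cst 0); have [r r0 hr] := D1_near u; exists r => // s /hr Ds.
by rewrite (D1_null Ds na).
Qed.

(** Invariance under multiples of [n] carries the derivative at the moved point back to the
    reference, which is critical. *)
Lemma B_null_l u n (a : 'cV[R]_d) : (forall g, lg g *m bar x0 n g = a) -> B n u = 0.
Proof.
move=> na; apply: slope_unique (B_slope n u) _.
apply: eq_slope (slope_cst 0); have [r r0 hr] := D1_near n; exists r => // s /hr Ds.
apply/esym/(slope_unique (is_D1_slope nU Ds (Uper_trivial u))).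
rewrite -(E1 u).
have := is_D1_slope nU D10 (Uper_trivial u); apply: eq_slope; exists 1 => // t _.
rewrite addrAC; apply/esym/(@energy_null _ _ (s *: a)) => g.
have := bar_lin fin_stab s n 0 g; rewrite bar0// !addr0 => ->.
by rewrite -scalemxAr na.
Qed.

(** Since [spin_field S] is affine in the configuration, [D1_spin] at the point moved by [s *: u]
    expresses the derivative in the direction [spin_field S cst0] as [- s * chi s]. As [chi]
    vanishes at 0 by criticality, this has slope 0. *)
Lemma B_spin_r u S : Skew S -> B u (spin_field S cst0) = 0.
Proof.
move=> SS; pose u' g : 'cV[R]_d := (lg g)^T *m (S *m (lg g *m u g)).
pose chi s := DE (cst0 + s *: u) u'.
have chi0 : chi 0 = 0 by rewrite /chi scale0r addr0 E1.
have hchi : has_slope chi (B u u') := B_slope u u'.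
apply: slope_unique (B_slope u _) _.
apply: (@eq_slope _ (fun s => - s * chi s)).
  have [r r0 hr] := D1_near u; exists r => // s /hr Ds.
  have := D1_spin SS Ds.
  have -> : spin_field S (cst0 + s *: u) = s *: u' + spin_field S cst0.
    apply/funext => g; rewrite -[RHS]/(s *: u' g + spin_field S cst0 g) /spin_field /u'.
    rewrite -[(_ + _) g]/(x0 + s *: u g) actD !mulmxDr -!scalemxAr.
    by rewrite addrC.
  case: (Ds) => -[lD _] _; rewrite lD; try exact: Uper_trivial.
  by move=> /eqP; rewrite addrC addr_eq0 => /eqP ->; rewrite mulNr.
(* Error tolerance 1 already shows that [chi s] is at most [m * |s|], so the product with [s] is
   quadratic. *)
move=> e e0; have [r r0 hr] := hchi 1 ltr01.
pose m := 1 + `|B u u'|; have m0 : 0 < m by rewrite ltr_pwDl.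
exists (Num.min r (e / m)); first by rewrite lt_min r0 divr_gt0.
move=> s; rewrite lt_min => /andP[/hr hs sm].
rewrite oppr0 mul0r mulr0 !subr0 normrM normrN mulrC ler_wpM2r//.
have : `|chi s| <= m * `|s|.
  have -> : chi s = (chi s - chi 0 - s * B u u') + s * B u u' by rewrite chi0; ring.
  apply: le_trans (ler_normD _ _) _; apply: le_trans (lerD hs (lexx _)) _.
  by rewrite normrM /m mulrDl [ `|s| * _]mulrC.
move=> /le_trans; apply; rewrite mulrC; move: sm; rewrite ltr_pdivlMr// => /ltW.
by [].
Qed.

(** Rotated references are critical too: the derivative there in direction [u] equals one at the
    original reference in the back-rotated direction [u']. Hence it is 0 along the rotation curve,
    and its slope there is [B] at the velocity. *)
Lemma B_spin_l u S : Skew S -> B (spin_field S cst0) u = 0.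
Proof.
move=> SS; have [Q [r [M [oQ QE hM rM]]]] := rotation_curve cst0 SS.
have [[Bl Br [c hc]] _ hB] := D2B.
have U_ := Uper_trivial.
have DB : is_D1 U sup_norm (fun w => DE w u) cst0 (fun w => B w u).
  split; first by split=> [a h k _ _|]; [exact: Bl|exists (c * sup_norm u) => h _; rewrite mulrAC; exact: hc].
  move=> e e0; have u1 : 0 < `|sup_norm u| + 1 by rewrite ltr_wpDl.
  have [q q0 hq] := hB _ (divr_gt0 e0 u1); exists q => // h Uh hn.
  have [_ /(_ u (U_ _)) hu] := hq h Uh hn; apply: le_trans hu _.
  have [_ _ nn] := nU; have [m m0 /(_ 1)] := nn h Uh; rewrite scale1r => /andP[h0 _].
  rewrite mulrAC ler_wpM2r//; apply: (@le_trans _ _ (e / (`|sup_norm u| + 1) * (`|sup_norm u| + 1))).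
    apply: ler_wpM2l; first by rewrite ltW// divr_gt0.
    by rewrite ler_wpDr// ler_norm.
  by rewrite divfK// gt_eqF.
have := curve_slope nU DB (U_ _) (fun t => U_ (r t)) hM rM.
under [X in has_slope X]funext do rewrite -QE.
have near0 : exists2 q, 0 < q & forall t, `|t| < q ->
    is_D1 U sup_norm E (rotate (Q t) cst0) (DE (rotate (Q t) cst0)).
  have [q q0 hq] := hB 1 ltr01.
  have M0 : 0 <= M by apply: le_trans (rM 0 1%g); exact: enorm_ge0.
  exists (Num.min 1 (q / (2 * M + 1))).
    by rewrite lt_min ltr01 divr_gt0// ltr_wpDl// mulr_ge0.
  move=> t; rewrite lt_min => /andP[t1 tq]; rewrite QE.
  apply: (hq _ (U_ _) _).1.
  have /andP[_ kM] : 0 <= sup_norm (t *: (2 *: spin_field S cst0 + t *: r t)) <= `|t| * (2 * M + 1).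
    apply: le_sup_norm => [|g]; first by rewrite mulr_ge0// addr_ge0// mulr_ge0.
    rewrite -[X in enorm X]/(t *: ((2 *: spin_field S cst0) g + t *: r t g)) enormZ ler_wpM2l//.
    apply: le_trans (enormD _ _) _; rewrite mulr_natl mulr2n -addrA.
    apply: lerD; first exact: hM.
    rewrite enormZ ler_wpDr//; apply: le_trans (ler_pM _ _ (ltW t1) (rM t g)) _; rewrite ?mul1r//.
    exact: enorm_ge0.
  by apply: le_lt_trans kM _; rewrite -ltr_pdivlMr// ltr_wpDl// mulr_ge0.
have DE0 t : is_D1 U sup_norm E (rotate (Q t) cst0) (DE (rotate (Q t) cst0)) ->
    DE (rotate (Q t) cst0) u = 0.
  move=> Dt; pose u' g : 'cV[R]_d := (lg g)^T *m ((Q t)^T *m (lg g *m u g)).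
  apply: slope_unique (is_D1_slope nU Dt (U_ u)) _; rewrite -(E1 u').
  have := is_D1_slope nU D10 (U_ u'); apply: eq_slope; exists 1 => // s _.
  rewrite -(energy_rotate _ (oQ t)); congr E; apply/funext => g.
  rewrite -[RHS]/(rotate (Q t) cst0 g + s *: u g) /rotate -[(_ + _) g]/(x0 + s *: u' g).
  rewrite actD !mulmxDr addrACA; congr (_ + _).
  have QK : Q t *m (Q t)^T = 1%:M by exact/mulmx1C/eqP/oQ.
  rewrite -!scalemxAr -scalerDr /u'; congr (_ *: _).
  rewrite !(mulmxA (lg g) (lg g)^T) linVK mul1mx mulmxBl mul1mx mulmxBr.
  rewrite (mulmxA (Q t) (Q t)^T) QK mul1mx (mulmxA (lg g)^T (lg g)) linK mul1mx.
  by rewrite addrC subrK.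
move=> hs; have : B (2 *: spin_field S cst0) u = 0.
  apply: slope_unique hs _; apply: eq_slope (slope_cst 0).
  by have [q q0 hq] := near0; exists q => // t /hq Dt; rewrite DE0.
have := Bl 2 (spin_field S cst0) 0 u (U_ _) (U_ _) (U_ _).
have -> : B 0 u = 0.
  by have := Bl (-1) 0 0 u (U_ _) (U_ _) (U_ _); rewrite scaler0 addr0 mulN1r addNr.
by rewrite !addr0 => -> /eqP; rewrite mulf_eq0 pnatr_eq0/= => /eqP.
Qed.

Lemma B_iso u v n n' S S' (a a' : 'cV[R]_d) : Skew S -> Skew S' ->
  (forall g, lg g *m bar x0 n g = a) -> (forall g, lg g *m bar x0 n' g = a') ->
  B (spin_field S cst0 + n + u) (spin_field S' cst0 + n' + v) = B u v.
Proof.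
have [[Bl Br _] _ _] := D2B; have U_ := Uper_trivial.
have BD x y z : B (x + y) z = B x z + B y z.
  by have := Bl 1 x y z (U_ _) (U_ _) (U_ _); rewrite scale1r mul1r.
have BDr x y z : B z (x + y) = B z x + B z y.
  by have := Br 1 x y z (U_ _) (U_ _) (U_ _); rewrite scale1r mul1r.
move=> SS SS' na na'.
by rewrite !BD B_spin_l// (B_null_l _ na) !add0r !BDr B_spin_r// (B_null_r _ na') !add0r.
Qed.

Lemma bar_stab u g h : stab x0 h -> lg h *m bar x0 u (g * h)%g = bar x0 u g.
Proof.
move=> Sh; rewrite /bar -scalemxAr; congr (_ *: _).
have -> : \sum_(k \in stab x0) (lg k *m u (g * k)%g) =
    \sum_(k \in stab x0) (lg (h * k)%g *m u (g * (h * k))%g).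
  have {1}-> : stab x0 = [set (h * k)%g | k in stab x0].
    apply/seteqP; split=> [k Sk|_ [k Sk <-]]; last exact: stabM.
    by exists (h^-1 * k)%g; rewrite ?mulVKg//; apply: stabM => //; exact: stabV.
  by rewrite fsbig_image// => a b _ _ /mulgI.
rewrite !fsum_fset// mulmx_sumr; apply: eq_bigr => k _.
by rewrite mulmxA -linM mulgA.
Qed.

Variables (P : set (elt G)) (Sk : set 'M[R]_d).
Hypotheses (adP : admissible x0 P) (fG : finite_set [set: elt G]).
Hypotheses (Sk0 : Sk 0) (SkL : forall a A B, Sk A -> Sk B -> Sk (a *: A + B)).
Hypothesis SkS : Sk `<=` Skew.

(** The rigid motion of the patch at the identity is extrapolated to the whole group. The gaps form
    the remainder, and a mean over a finite group controls each of its values. *)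
Lemma iso_decomposition : exists2 c, 0 <= c & forall u, exists r n S (a : 'cV[R]_d),
  [/\ Skew S, forall g, lg g *m bar x0 n g = a, u = spin_field S cst0 + n + r
    & forall g, enorm (r g) <= c * seminorm x0 T C P Sk u].
Proof.
have P1 := admissible1 adP.
have [c c0 hc] : dominated (fun (D : patches x0 P) g =>
    \sum_(k <- fset_set [set: elt G]) nsq (gap k D g)).
  by apply: dominated_sum => k; exact: gap_msdom.
have [_ _ [N MN] _ _] := tameT; have cN := M0_cell tameT MN.
pose m : R := cardR (C N) * c.
have m0 : 0 <= m by rewrite mulr_ge0// ltW// (cell_card_gt0 cN).
exists (Num.sqrt m); first exact: sqrtr_ge0.
move=> u; have uN := hperiodic_trivial u MN.
have [D [DC DH Du Dd]] := patches_of tameT adP Sk0 SkL SkS MN uN.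
pose r g := (lg g)^T *m gap g D 1%g; pose S := spin D 1%g.
have gapE g : gap g D 1%g = lg g *m bar x0 u g - pshift D 1%g - S *m (act (val g) x0 - x0).
  by rewrite /gap Du mul1g.
have br g : bar x0 r g = r g.
  apply: bar_fixed => // h Sh; rewrite /r !gapE linM trmx_mul !mulmxA linVK mul1mx (act_stab g Sh).
  by rewrite -[lg g *m lg h *m _]mulmxA bar_stab.
have bs g : bar x0 (spin_field S cst0) g = spin_field S cst0 g.
  apply: bar_fixed => // h Sh; rewrite /spin_field linM trmx_mul !mulmxA linVK mul1mx.
  by rewrite (act_stab g Sh).
(* The middle term symmetrizes to a translation; [- S *m x0] appears since [spin_field] rotates
   about the origin and the gaps about [x0]. *)
exists r, (u - spin_field S cst0 - r), S, (pshift D 1%g - S *m x0); split.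
- exact: spin_skew.
- move=> g; rewrite !(barB fin_stab) bs br /r /spin_field gapE !mulmxBr.
  rewrite !(mulmxA (lg g) (lg g)^T) linVK !mul1mx.
  by apply/matrixP => i j; rewrite !mxE; ring.
- by rewrite addrA [_ + (u - _)]addrC !subrK.
move=> g; rewrite /r enorm_orth; last exact: trlin_orth.
rewrite -ler_sqr ?nnegrE ?enorm_ge0 ?mulr_ge0 ?sqrtr_ge0//.
rewrite sqr_enorm exprMn sqr_sqrtr// (seminorm_sqr _ tameT adP MN uN) -Dd -DC.
pose f h := \sum_(k <- fset_set [set: elt G]) nsq (gap k D h).
have f0 h : 0 <= f h by apply: sumr_ge0 => k _; exact: nsq_ge0.
apply: (@le_trans _ _ (f 1%g)).
  rewrite /f (big_fsetD1 g)/= ?in_fset_set ?inE// lerDl.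
  by apply: sumr_ge0 => k _; exact: nsq_ge0.
have fH : hperiodic (cellH D) f by rewrite DH; exact: hperiodic_trivial.
apply: le_trans (le_term_avg (patches_cell D) 1%g fH f0) _.
rewrite /m -mulrA DC; apply: ler_wpM2l; first exact: ltW (cell_card_gt0 cN).
by rewrite -DC; exact: (hc D).
Qed.

(** Rigid parts do not contribute to [B], and the remainders are bounded in sup norm by the
    seminorms. *)
Lemma finite_D2_bounded : bounded_wrt U (seminorm x0 T C P Sk) B.
Proof.
have [c c0 hc] := iso_decomposition.
have [[_ _ [b hb]] _ _] := D2B.
exists (`|b| * c ^+ 2 + 1); first by rewrite ltr_wpDl// mulr_ge0// sqr_ge0.
move=> u v _ _.
have [r [n [S [a [SS na {2}-> hr]]]]] := hc u.
have [r' [n' [S' [a' [SS' na' {2}-> hr']]]]] := hc v.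
rewrite (B_iso _ _ SS SS' na na').
set p := seminorm _ _ _ _ _ u in hr *; set q := seminorm _ _ _ _ _ v in hr' *.
have p0 : 0 <= p by exact: seminorm_ge0.
have q0 : 0 <= q by exact: seminorm_ge0.
clearbody p q.
have /andP[r0 rp] := le_sup_norm (mulr_ge0 c0 p0) hr.
have /andP[r'0 rq] := le_sup_norm (mulr_ge0 c0 q0) hr'.
apply: le_trans (hb _ _ (Uper_trivial r) (Uper_trivial r')) _.
rewrite -!mulrA; apply: (@le_trans _ _ (`|b| * ((c * p) * (c * q)))).
  apply: (@le_trans _ _ (`|b| * (sup_norm r * sup_norm r'))).
    by rewrite ler_wpM2r ?mulr_ge0// ler_norm.
  by rewrite ler_wpM2l// ler_pM.
have pq : 0 <= p * q by rewrite mulr_ge0.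
have -> : `|b| * ((c * p) * (c * q)) = `|b| * c ^+ 2 * (p * q) by ring.
by rewrite ler_wpM2r// lerDl.
Qed.

End SecondDerivative.

Lemma finite_energy2_bounded (P : set (elt G)) (Sk : set 'M[R]_d) :
  admissible x0 P -> finite_set [set: elt G] ->
  Sk 0 -> (forall a A B, Sk A -> Sk B -> Sk (a *: A + B)) -> Sk `<=` Skew ->
  (forall u, U u -> energy1 T C V u = 0) ->
  bounded_wrt U (seminorm x0 T C P Sk) (energy2 T C V).
Proof.
move=> adP fG Sk0 SkL SkS E1.
have [D2B|->] := energy2_cases T C V; last first.
  by exists 1 => // u v _ _; rewrite normr0 !mulr_ge0// seminorm_ge0.
apply: finite_D2_bounded => // u.
exact: E1 (Uper_trivial u).
Qed.
End FiniteGroup.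

(** * Discreteness of space groups *)

Lemma inj_finite (T U : Type) (A : set T) (B : set U) (f : T -> U) :
  (forall x, A x -> B (f x)) ->
  (forall x y, A x -> A y -> f x = f y -> x = y) -> finite_set B -> finite_set A.
Proof.
move=> AB fI fB.
have inj : {in A &, injective f} by move=> x y /set_mem Ax /set_mem Ay; exact: fI.
by rewrite -(eq_finite_set (inj_card_eq inj)); apply: sub_finite_set fB => _ [x /AB ? <-].
Qed.

Section SpaceGroup.
Context {R : realType} {d1 d2 : nat}.
Local Notation d := (d1 + d2)%N.
Variables (G : groupClosed (euclid R d)).
Implicit Types (g h k t s : elt G) (N n : nat).

Local Notation lg g := (lin (val g)).
Local Notation tg g := (tra (val g)).

Lemma traM g h : tg (g * h)%g = tg g + lg g *m tg h.
Proof. by []. Qed.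

Lemma traV g : tg g^-1%g = - ((lg g)^T *m tg g).
Proof. by []. Qed.

Lemma elt_ext g h : lg g = lg h -> tg g = tg h -> g = h.
Proof.
move=> lgh tgh; apply/val_inj/val_inj.
by rewrite [LHS]surjective_pairing [RHS]surjective_pairing; congr pair.
Qed.

Lemma lin_expg t n : lg t = 1%:M -> lg (t ^+ n)%g = 1%:M.
Proof. by move=> t1; elim: n => // n IH; rewrite expgS linM t1 mul1mx. Qed.

Lemma tra_expg t n : lg t = 1%:M -> tg (t ^+ n)%g = n%:R *: tg t.
Proof.
move=> t1; elim: n => [|n IH]; first by rewrite scale0r.
by rewrite expgS traM t1 mul1mx IH -[n.+1]add1n natrD scalerDl scale1r.
Qed.

Lemma lin_conj g t : lg t = 1%:M -> lg (g * t * g^-1)%g = 1%:M.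
Proof. by move=> t1; rewrite !linM t1 mulmx1 linV linVK. Qed.

Lemma tra_conj g t : lg t = 1%:M -> tg (g * t * g^-1)%g = lg g *m tg t.
Proof.
move=> t1; rewrite !traM linM t1 mulmx1 traV mulmxN mulmxA linVK mul1mx.
by rewrite addrAC subrr add0r.
Qed.

Definition trans_group : set (elt G) := [set t | lg t = 1%:M].

Local Notation H N := (pow_set trans_group N).

Lemma pow_trans_lin N t : H N t -> lg t = 1%:M.
Proof. by move=> [s s1 <-]; exact: lin_expg. Qed.

(** Translations commute, so their [N]-th powers form a group, and conjugation maps translations to
    translations. *)
Lemma M0_trans N : (0 < N)%N -> M0 trans_group N.
Proof.
move=> N0; split=> //; split; first split.
- by rewrite inE; exists 1%g => //; rewrite expg1n.
- move=> x y; rewrite !inE => -[t t1 <-] [s s1 <-].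
  have ts1 : lg (t * s^-1)%g = 1%:M by rewrite linM linV t1 s1 trmx1 mulmx1.
  exists (t * s^-1)%g; first exact: ts1.
  apply: elt_ext; first by rewrite lin_expg// linM linV !lin_expg// trmx1 mulmx1.
  rewrite tra_expg// !traM !traV lin_expg// !tra_expg// lin_expg//.
  by rewrite t1 s1 trmx1 !mul1mx scalerBr.
- move=> g _ [t t1 <-]; exists (g * t * g^-1)%g; first exact: lin_conj.
  apply: elt_ext; first by rewrite lin_expg ?lin_conj// lin_expg.
  by rewrite tra_expg ?lin_conj// !tra_conj ?lin_expg// tra_expg// scalemxAr.
Qed.

Hypothesis space : space_group G.

Lemma lattice_basis : exists t : 'I_d -> elt G,
  (forall i, lg (t i) = 1%:M) /\ row_free (\matrix_i (tg (t i))^T).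
Proof.
have [_ [t [tP tfree]]] := space.
exists (fun i => exist _ (t i) (tP i).1); split=> [i|]; first by case: (tP i).
exact: tfree.
Qed.

(** Isolation of the origin in its orbit is transported to every orbit point by the isometries of
    [G], which makes the radius uniform. *)
Lemma orbit_separated : exists2 e, 0 < e & forall g h, enorm (tg g - tg h) < e -> tg g = tg h.
Proof.
have [/(_ 0)/= disc _] := space.
have act0 (g : euclid R d) : act g 0 = tra g by rewrite /act mulmx0 add0r.
have [|_ [W /nbhs_ballP[e /= e0 eW] WO]] := disc 0.
  by exists 1%g; [exact: gpred1|rewrite act0].
exists e => // g h gh.
have gE : tg (g^-1 * h)%g = (lg g)^T *m (tg h - tg g).
  by rewrite traM traV linV mulmxBr addrC.
have : (W `&` [set act g 0 | g in [set g : euclid R d | g \in G]]) (tg (g^-1 * h)%g).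
  split; last by exists (val (g^-1 * h)%g); [exact: valP|rewrite act0].
  apply: eW; split=> // i j; rewrite ord1 /ball/= mxE sub0r normrN.
  apply: le_lt_trans gh; rewrite gE.
  apply: le_trans (entry_enorm _ _) _; rewrite enorm_orth; last exact: trlin_orth.
  by rewrite -opprB -scaleN1r enormZ normrN1 mul1r.
rewrite WO /= gE => /(congr1 (mulmx (lg g))).
by rewrite mulmxA linVK mul1mx mulmx0 => /eqP; rewrite subr_eq0 => /eqP.
Qed.

(* g is determined by the orbit points g 0 and g (t_i 0) of the origin;
   discreteness leaves finitely many of them in a bounded region. *)
Lemma bounded_finite M : finite_set [set g : elt G | enorm (tg g) <= M].
Proof.
have [t [t1 tfree]] := lattice_basis.
have [e e0 sep] := orbit_separated.
(* Coordinates closer than [del] give a distance below [e], since [d] is less than the square of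
   [d.+1]; this includes [d = 0]. *)
pose del : R := e / d.+1%:R; have del0 : 0 < del by rewrite divr_gt0.
pose M' : R := `|M| + \sum_i enorm (tg (t i)).
have M'0 : 0 <= M' by rewrite addr_ge0// sumr_ge0// => i _; exact: enorm_ge0.
pose p g (o : option 'I_d) : 'cV[R]_d := tg (if o is Some i then (g * t i)%g else g).
have pM g o : enorm (tg g) <= M -> enorm (p g o) <= M'.
  move=> gM; case: o => [i|] /=; last first.
    apply: le_trans gM _; apply: le_trans (ler_norm _) _; rewrite lerDl.
    by rewrite sumr_ge0// => i _; exact: enorm_ge0.
  rewrite /p traM; apply: le_trans (enormD _ _) _; apply: lerD.
    exact: le_trans gM (ler_norm _).
  rewrite enorm_orth; last exact: lin_orth.
  by rewrite (bigD1 i)//= lerDl sumr_ge0// => j _; exact: enorm_ge0.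
pose K := Num.truncn (2 * M' / del).
(* Coordinates in units of [del], made nonnegative; equal integer parts mean a distance less than
   [del]. *)
pose cd g o (j : 'I_d) : R := (p g o j 0 + M') / del.
pose f g : {ffun option 'I_d * 'I_d -> 'I_K.+1} :=
  [ffun q => inord (Num.truncn (cd g q.1 q.2))].
have cd0 g o j : enorm (tg g) <= M -> 0 <= cd g o j.
  move=> /(pM _ o)/(le_trans (entry_enorm _ j)); rewrite ler_norml => /andP[h _].
  by rewrite divr_ge0 ?(ltW del0)//; lra.
have cdK g o j : enorm (tg g) <= M -> (Num.truncn (cd g o j) < K.+1)%N.
  move=> gM; rewrite ltnS; apply: le_truncn.
  rewrite ler_pM2r ?invr_gt0//.
  have := le_trans (entry_enorm _ j) (pM _ o gM); rewrite ler_norml => /andP[_ h].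
  by lra.
have close x y : 0 <= x -> 0 <= y -> Num.truncn x = Num.truncn y -> `|x - y| < 1 :> R.
  move=> x0 y0 xy; have := truncn_itv x0; have := truncn_itv y0; rewrite xy -natr1.
  by move=> /andP[? ?] /andP[? ?]; rewrite ltr_norml; lra.
apply: (@inj_finite _ _ _ setT f) => //.
move=> g h gM hM fgh.
have pE o : p g o = p h o.
  apply: sep; rewrite -/(p g o) -/(p h o).
  have cl j : `|p g o j 0 - p h o j 0| < del.
    have := congr1 (fun F : {ffun option 'I_d * 'I_d -> 'I_K.+1} => val (F (o, j))) fgh.
    rewrite /f !ffunE !val_insubd !cdK//= => /(close _ _ (cd0 _ _ _ gM) (cd0 _ _ _ hM)).
    rewrite /cd -mulrBl normrM [ `|del^-1|]gtr0_norm ?invr_gt0// ltr_pdivrMr// mul1r.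
    by rewrite opprD addrACA subrr addr0.
  rewrite -ltr_sqr ?nnegrE ?enorm_ge0 ?(ltW e0)// sqr_enorm nsqE.
  apply: (@le_lt_trans _ _ (\sum_(j < d) del ^+ 2)).
    apply: ler_sum => j _; rewrite !mxE -real_normK ?num_real// ler_sqr ?nnegrE ?(ltW del0)//.
    exact: ltW.
  rewrite sumr_const card_ord -mulr_natl /del expr_div_n mulrCA gtr_pMr ?exprn_gt0//.
  rewrite ltr_pdivrMr ?exprn_gt0// mul1r -natrX ltr_nat expnS expn1.
  by rewrite mulSn; exact: leq_addr.
have tgE : tg g = tg h := pE None.
apply: elt_ext => //.
have uB : (\matrix_i (tg (t i))^T) \in unitmx by rewrite -row_free_unit.
apply: trmx_inj; apply: (can_inj (mulKmx uB)); apply/row_matrixP => i.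
rewrite !row_mul rowK -!trmx_mul; congr (_^T).
have := pE (Some i); rewrite /p !traM tgE => /addrI.
by [].
Qed.

Lemma lattice_point (t : 'I_d -> elt G) (z : 'I_d -> int) :
  (forall i, lg (t i) = 1%:M) ->
  exists s, lg s = 1%:M /\ tg s = \sum_i (z i)%:~R *: tg (t i).
Proof.
move=> t1; suff h (e : seq 'I_d) :
    exists s, lg s = 1%:M /\ tg s = \sum_(i <- e) (z i)%:~R *: tg (t i) by exact: h.
elim: e => [|i e [s [s1 sE]]].
  by exists 1%g; rewrite big_nil.
have [r [r1 rE]] : exists r : elt G, lg r = 1%:M /\ tg r = (z i)%:~R *: tg (t i).
  case: (z i) => n; first by exists (t i ^+ n)%g; rewrite lin_expg// tra_expg.
  exists (t i ^+ n.+1)^-1%g; rewrite linV traV lin_expg// trmx1 mul1mx tra_expg//.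
  by rewrite NegzE mulrNz scaleNr.
exists (r * s)%g; rewrite linM r1 s1 mulmx1 traM r1 mul1mx rE sE big_cons.
by [].
Qed.

(** The translation part of [g] is reduced modulo [N] times the lattice. *)
Lemma cocompact N : (0 < N)%N -> exists M, forall g, exists2 s, H N s & enorm (tg (s * g)%g) <= M.
Proof.
move=> N0; have [t [t1 tfree]] := lattice_basis.
have N0R : 0 < N%:R :> R by rewrite ltr0n.
have uB : (\matrix_i (tg (t i))^T) \in unitmx by rewrite -row_free_unit.
exists (N%:R * \sum_i enorm (tg (t i))) => g.
pose c := (tg g)^T *m invmx (\matrix_i (tg (t i))^T).
have gE : tg g = \sum_i c 0 i *: tg (t i).
  apply: trmx_inj; rewrite linear_sum/= -[LHS](mulmxKV uB) mulmx_sum_row.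
  by apply: eq_bigr => i _; rewrite rowK linearZ.
(* Subtracting [N] times these floors leaves lattice coordinates between 0 and [N]. *)
have [s [s1 sE]] := lattice_point (fun i => - Num.floor (c 0 i / N%:R)) t1.
exists (s ^+ N)%g; first by exists s.
rewrite traM lin_expg// mul1mx tra_expg// sE gE scaler_sumr -big_split/= mulr_sumr.
have tri (I : Type) (r : seq I) (x : I -> 'cV[R]_d) :
    enorm (\sum_(i <- r) x i) <= \sum_(i <- r) enorm (x i).
  elim: r => [|i r IH]; first by rewrite !big_nil enormE ip0r sqrtr0.
  by rewrite !big_cons; apply: le_trans (enormD _ _) _; rewrite lerD2l.
apply: le_trans (tri _ _ _) _; apply: ler_sum => i _.
rewrite scalerA -scalerDl enormZ ler_wpM2r ?enorm_ge0//.
have /andP[] := floor_itv (c 0 i / N%:R).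
rewrite ler_pdivlMr// ltr_pdivrMr// intrD mulrDl mul1r rmorphN/= => h1 h2.
rewrite ler_norml; nra.
Qed.

(** A left factor from [H N] moves each representative into a bounded region. By normality the coset
    is unchanged, so distinct representatives stay distinct. *)
Lemma cell_finite N (A : set (elt G)) : (0 < N)%N -> representatives A (H N) -> finite_set A.
Proof.
move=> N0 rA; have [M hM] := cocompact N0.
have [f fP] := @choice _ _ (fun g s => H N s /\ enorm (tg (s * g)%g) <= M)
  (fun g => ltac:(by have [s Hs sM] := hM g; exists s)).
have [[grpH H1] nH] := (M0_trans N0).2.
apply: (@inj_finite _ _ _ [set g | enorm (tg g) <= M] (fun c => f c * c)%g).
- by move=> c _; case: (fP c).
- move=> x y Ax Ay xy.
  have Hxy : H N (x^-1 * y)%g.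
    have -> : (x^-1 * y = x^-1 * ((f y)^-1 * f x) * x^-1^-1)%g.
      apply: (mulgI x); rewrite !mulgA mulgV !mul1g invgK -mulgA xy.
      by rewrite mulKg.
    apply: nH.
    have gc := group_closedM (conj grpH H1); have gv := group_closedV (conj grpH H1).
    apply/set_mem; apply: gc; first by apply: gv; apply/mem_set; case: (fP y).
    by apply/mem_set; case: (fP x).
  have [c [_ cu]] := rA y.
  rewrite -(cu x)// (cu y)//; split=> //; rewrite mulVg.
  exact: set_mem grpH.
- exact: bounded_finite.
Qed.

Variable x0 : 'cV[R]_d.

Lemma stab_finite : finite_set (stab x0 : set (elt G)).
Proof.
apply: sub_finite_set (bounded_finite (2 * enorm x0)) => g /= gx.
have -> : tg g = x0 + (-1) *: (lg g *m x0).
  by rewrite -{1}gx scaleN1r /act addrC addKr.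
apply: le_trans (enormD _ _) _.
by rewrite enormZ normrN1 mul1r enorm_orth ?mulr_natl ?mulr2n//; exact: lin_orth.
Qed.

Lemma tame_trans C : (forall N, M0 trans_group N -> representatives (C N) (H N)) ->
  tame x0 trans_group C.
Proof.
move=> rC; split.
- move=> N MN; split; [exact: MN.2|exact: rC|].
  by apply: cell_finite (rC N MN); case: MN.
- move=> N M [N0 _] [M0 _]; exists (N * M)%N; first by apply: M0_trans; rewrite muln_gt0 N0.
  split=> _ [s s1 <-]; first by exists (s ^+ M)%g; [exact: lin_expg|rewrite -expgnA mulnC].
  by exists (s ^+ N)%g; [exact: lin_expg|rewrite -expgnA].
- by exists 1%N; exact: M0_trans.
- by move=> N t _; exact: pow_trans_lin.
- exact: stab_finite.
Qed.

Lemma space_spin_msdom P : admissible x0 P ->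
  forall w : 'cV[R]_d, msdom (fun (D : patches x0 P) g => spin D g *m w).
Proof.
move=> adP; have [t [t1 tfree]] := lattice_basis.
(* Conjugation preserves the length of a translation, so all conjugates of the basis lie in one
   bounded, hence finite, set. *)
apply: (@spin_msdom _ _ _ G x0 P t _ adP (admissible1 adP) t1 _
  (bounded_finite (\sum_i enorm (tg (t i)))) tfree) => g i /=.
have := tra_conj g^-1%g (t1 i); rewrite invgK => ->.
rewrite enorm_orth; last exact: trlin_orth.
by rewrite (bigD1 i)//= lerDl sumr_ge0// => j _; exact: enorm_ge0.
Qed.

(** Nonzero translations have length at least [e], so those in [H N] are longer than
    [act (val k) x0 - x0] once [N] is large. *)
Lemma sparse_translates k : act (val k) x0 <> x0 -> exists2 N, M0 trans_group N &
  forall t, H N t -> act (val t) x0 <> act (val k) x0.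
Proof.
move=> kx; have [e e0 sep] := orbit_separated.
pose w := act (val k) x0 - x0.
pose N := (Num.truncn (enorm w / e)).+1.
exists N; first exact: M0_trans.
move=> _ [s s1 <-] sk.
have wE : w = N%:R *: tg s by rewrite /w -sk /act lin_expg// mul1mx tra_expg// addrC addKr.
have : ~ enorm (tg s) < e.
  move=> se; apply: kx; apply/eqP; rewrite -subr_eq0 -/w wE.
  rewrite (sep s 1%g _); first by rewrite scaler0.
  by rewrite subr0.
move=> /negP; rewrite -leNgt => es.
have /andP[_] := truncn_itv (divr_ge0 (enorm_ge0 w) (ltW e0)).
rewrite ltr_pdivrMr// -/N wE enormZ normr_nat ltr_pM2l ?ltr0n//.
by rewrite ltNge es.
Qed.

End SpaceGroup.

(** * Normal form *)

Section NormalForm.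
Context {R : realType} {d1 d2 : nat}.
Local Notation d := (d1 + d2)%N.
Variables (S : groupClosed (euclid R d2)) (G : groupClosed (euclid R d)).
Variables (x0 : 'cV[R]_d) (T : set (elt G)) (C : nat -> set (elt G)).

Hypothesis normalG : normal_form S G.
Hypothesis bijT : set_bij T (translations S) (fun t => pi_S (val t)).
Hypothesis repC : forall N, M0 T N -> representatives (C N) (pow_set T N).

Lemma pi_S_oplus (g : euclid R d) (A : 'M[R]_d1) (s : euclid R d2) :
  isom_pair g = oplus A s -> pi_S g = s.
Proof.
move=> gE; apply/val_inj.
have e : (drsubmx (lin g), dsubmx (tra g)) = isom_pair s.
  by rewrite /lin /tra gE /oplus/= block_mxKdr col_mxKd /lin /tra -surjective_pairing.
rewrite /pi_S e val_insubd; case: ifP => // /negP[].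
exact: isom_pairP.
Qed.

(** Translation parts in normal form vanish in the first [d1] coordinates, so they can span the
    whole space only if there are none. *)
Lemma space_group_d1 : space_group G -> d1 = 0%N.
Proof.
move=> [_ [t [tP tfree]]]; have [_ _ normal _] := normalG.
case: (posnP d1) => // d1_gt0; exfalso.
pose i0 := lshift d2 (Ordinal d1_gt0).
have uB : (\matrix_i (tra (t i))^T) \in unitmx by rewrite -row_free_unit.
have z : (\matrix_i (tra (t i))^T) *m (delta_mx i0 0 : 'cV[R]_d) = 0.
  apply/matrixP => i j; rewrite -colE !mxE.
  have [A [s [_ _ tE]]] := normal _ (tP i).1.
  by rewrite /tra tE /oplus /= col_mxEu mxE.
have := congr1 (mulmx (invmx (\matrix_i (tra (t i))^T))) z.
rewrite mulKmx// mulmx0 => /matrixP/(_ i0 0); rewrite !mxE !eqxx => /eqP.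
by rewrite oner_eq0.
Qed.

(** With no first block, [pi_S] is injective on [G] and preserves being a translation, so [T] must
    be the full translation subgroup. *)
Lemma space_group_T : space_group G -> T = @trans_group _ _ _ G.
Proof.
move=> spaceG; have e := space_group_d1 spaceG.
have [_ _ normal imG] := normalG; have [TS _ surj] := bijT.
have thin (A B : 'M[R]_d1) : A = B by apply/matrixP => i; exfalso; case: i; rewrite e.
have thinc (A B : 'cV[R]_d1) : A = B by apply/matrixP => i; exfalso; case: i; rewrite e.
have piE (g : elt G) : isom_pair (val g) = oplus 1%:M (pi_S (val g)).
  have [A [s [_ _ gE]]] := normal _ (valP g).
  by rewrite (pi_S_oplus gE) gE (thin A 1%:M).
apply/seteqP; split=> [t /TS[_ t1]|g g1].
  by rewrite /trans_group/= /lin piE /oplus/= t1 -scalar_mx_block.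
have pg : pi_S (val g) \in S.
  have : (pi_S @` [set g | g \in G]) (pi_S (val g)) by exists (val g) => //; exact: valP.
  by rewrite imG.
have [|t Tt tg] := surj (pi_S (val g)).
  split=> //; have := g1; rewrite /trans_group/= /lin piE /oplus/= => h.
  by rewrite /lin -[LHS](block_mxKdr (1%:M : 'M[R]_d1) 0 0) h (scalar_mx_block d1 d2) block_mxKdr.
suff -> : g = t by [].
by apply/val_inj/val_inj; rewrite [LHS]piE [RHS]piE tg.
Qed.

Hypothesis finG : finite_set [set: elt G].

(** Otherwise [S], an image of the finite group, would contain the infinitely many powers of a
    nonzero translation. *)
Lemma finite_d2 : d2 = 0%N.
Proof.
have [[_ [t [tP tfree]]] _ _ imG] := normalG.
case: (posnP d2) => // d2_gt0; exfalso.
have finS : finite_set [set s | s \in S].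
  rewrite -imG; apply: finite_image.
  have -> : [set g : euclid R d | g \in G] = [set val g | g in [set: elt G]].
    apply/seteqP; split=> [g gG|_ [g _ <-]]; last exact: valP.
    by exists (exist _ g gG).
  exact: finite_image.
pose i0 := Ordinal d2_gt0; have [tS t1] := tP i0.
have lin_pow n : lin (t i0 ^+ n)%g = 1%:M.
  by elim: n => // n IH; rewrite expgS -[LHS]/(lin (t i0) *m lin (t i0 ^+ n)%g) t1 mul1mx.
have tra_pow n : tra (t i0 ^+ n)%g = n%:R *: tra (t i0).
  elim: n => [|n IH]; first by rewrite scale0r.
  rewrite expgS -[LHS]/(tra (t i0) + lin (t i0) *m tra (t i0 ^+ n)%g) t1 mul1mx IH.
  by rewrite -[n.+1]add1n natrD scalerDl scale1r.
have t0 : tra (t i0) != 0.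
  apply/eqP => t0; have uB : (\matrix_i (tra (t i))^T) \in unitmx by rewrite -row_free_unit.
  have := congr1 (mulmx^~ (invmx (\matrix_i (tra (t i))^T))) (rowK (fun i => (tra (t i))^T) i0).
  rewrite /= t0 trmx0 mul0mx -row_mul mulmxV// => /matrixP/(_ 0 i0).
  by rewrite !mxE eqxx => /eqP; rewrite oner_eq0.
apply: infinite_nat; apply: (@inj_finite _ _ _ _ (fun n => t i0 ^+ n)%g _ _ finS).
  by move=> n _; exact: gpredXn.
move=> n m _ _ /(congr1 tra); rewrite !tra_pow => /eqP.
by rewrite -subr_eq0 -scalerBl scaler_eq0 (negbTE t0) orbF subr_eq0 eqr_nat => /eqP.
Qed.

Lemma finite_T : exists t, T = [set t].
Proof.
have e := finite_d2; have [TS inj surj] := bijT.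
have thin (s s' : euclid R d2) : s = s'.
  apply/val_inj; case: (val s) (val s') => [A b] [A' b'].
  by congr pair; apply/matrixP => i; exfalso; case: i; rewrite e.
have [|t Tt _] := surj 1%g; first by split; [exact: gpred1|].
exists t; apply/seteqP; split=> [s Ts|_ ->//] /=.
by apply: inj; [exact: mem_set|exact: mem_set|exact: thin].
Qed.

(** Here [pow_set T N] has a single element; being a subgroup, it is trivial. *)
Lemma finite_M0 N t : M0 T N -> pow_set T N t -> t = 1%g.
Proof.
have [t0 TE] := finite_T.
move=> [_ [[+ _] _]]; rewrite inE TE => -[s -> s1] [s' -> <-].
exact: s1.
Qed.

Lemma finite_tame : tame x0 T C.
Proof.
have [t TE] := finite_T.
have MP := finite_M0.
split.
- move=> N MN; split; [exact: MN.2|exact: repC|].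
  by apply: sub_finite_set finG.
- move=> N M MN MM; exists N => //; split=> // s /(MP _ _ MN) ->.
  by have [_ [[+ _] _]] := MM; rewrite inE.
(* [M0] is nonempty because the single element of [T] has finite order, by the pigeonhole
   principle. *)
- have [n [m [nm tnm]]] : exists n m, (n < m)%N /\ (t ^+ n = t ^+ m)%g.
    apply: contrapT => h; apply: infinite_nat.
    apply: (@inj_finite _ _ _ _ (fun n => t ^+ n)%g _ _ finG) => // n m _ _ tnm.
    case: (ltngtP n m) => // nm; exfalso; apply: h; first by exists n, m.
    by exists m, n.
  exists (m - n)%N; split; first by rewrite subn_gt0.
  have t1 : (t ^+ (m - n))%g = 1%g.
    by apply: (mulgI (t ^+ n)%g); rewrite -expgnDr subnKC ?mulg1 ?(ltnW nm).
  have -> : pow_set T (m - n) = [set 1%g].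
    by rewrite /pow_set TE image_set1 t1.
  split; first split; first by rewrite inE.
    by move=> x y; rewrite !inE => -> ->; rewrite mulgV.
  by move=> g _ ->; rewrite /= mulg1 mulgV.
- by move=> N s MN /(MP _ _ MN) ->.
- exact: sub_finite_set finG.
Qed.

Lemma finite_Skew00 : @Skew00 R d1 d2 = Skew.
Proof.
have e := finite_d2; apply/seteqP; split=> [A []//|A SA]; split=> //.
by split; apply/matrixP => i j; exfalso; [case: j|case: i|case: i]; rewrite e.
Qed.

End NormalForm.

Lemma Skew_lin (R : realType) (n : nat) a (A B : 'M[R]_n) :
  Skew A -> Skew B -> Skew (a *: A + B).
Proof. by rewrite /Skew/= => SA SB; rewrite linearP/= SA SB opprD scalerN. Qed.

Lemma Skew_0 (R : realType) (n : nat) : @Skew R n 0.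
Proof. by rewrite /Skew/= trmx0 oppr0. Qed.

Lemma Skew00_lin (R : realType) (d1 d2 : nat) a (A B : 'M[R]_(d1 + d2)) :
  Skew00 A -> Skew00 B -> Skew00 (a *: A + B).
Proof.
move=> [SA [A1 A2 A3]] [SB [B1 B2 B3]]; split; first exact: Skew_lin.
have ur : ursubmx (a *: A + B) = a *: ursubmx A + ursubmx B.
  by apply/matrixP => i j; rewrite !mxE.
have dl : dlsubmx (a *: A + B) = a *: dlsubmx A + dlsubmx B.
  by apply/matrixP => i j; rewrite !mxE.
have dr : drsubmx (a *: A + B) = a *: drsubmx A + drsubmx B.
  by apply/matrixP => i j; rewrite !mxE.
by rewrite ur dl dr A1 A2 A3 B1 B2 B3 !scaler0 !addr0.
Qed.

Lemma Skew00_0 (R : realType) (d1 d2 : nat) : @Skew00 R d1 d2 0.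
Proof.
split; first exact: Skew_0.
by split; apply/matrixP => i j; rewrite !mxE.
Qed.

Theorem theorem3p19 (R : realType) (d1 d2 : nat)
    (S : groupClosed (euclid R d2)) (G : groupClosed (euclid R (d1 + d2)))
    (x0 : 'cV[R]_(d1 + d2)) (T : set (elt G)) (C : nat -> set (elt G))
    (V : (cosets_star G x0 -> 'cV[R]_(d1 + d2)) -> R) (P : set (elt G)) :
  normal_form S G ->
  normalized_coords G x0 ->
  set_bij T (translations S) (fun t => pi_S (val t)) ->
  (forall N, M0 T N -> representatives (C N) (pow_set T N)) ->
  orbit_of G x0 setT <> [set x0] ->
  interaction_potential V ->
  finite_range V ->
  admissible x0 P ->
  let norm := seminorm x0 T C P Skew in
  let norm00 := seminorm x0 T C P Skew00 in
  let E1 := energy1 T C V in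
  let E2 := energy2 T C V in
  let lambda := stability_constant T C V P Skew in
  let lambda00 := stability_constant T C V P Skew00 in
  (finite_set [set: elt G] -> (forall u, Uper T u -> E1 u = 0) ->
     [/\ forall u, Uper T u -> norm u = norm00 u,
         bounded_wrt (Uper T) norm E2,
         lambda = lambda00
       & lambda \is a fin_num]) /\
  (space_group G ->
     [/\ bounded_wrt (Uper T) norm E2,
         bounded_wrt (Uper T) norm00 E2,
         lambda \is a fin_num
       & lambda00 \is a fin_num]).
Proof.
move=> normalG _ bijT repC orb [V_orth V_C2 _] [A fA V_A] adP norm norm00 E1 E2 lambda lambda00.
have [k Pk kx] := moving_patch adP orb.
have Skew00S : @Skew00 R d1 d2 `<=` Skew by move=> B [].
split=> [finG E10|spaceG].
  have tameT := finite_tame x0 normalG bijT repC finG.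
  have bnd : bounded_wrt (Uper T) norm E2.
    apply: (finite_energy2_bounded tameT _ V_orth adP finG) => //.
    - by move=> N t; exact: (finite_M0 normalG bijT finG).
    - exact: Skew_0.
    - by move=> *; exact: Skew_lin.
  split.
  - by move=> u _; rewrite /norm00 (finite_Skew00 normalG finG).
  - exact: bnd.
  - by rewrite /lambda00 (finite_Skew00 normalG finG).
  apply: stability_fin_num bnd _.
  have [_ _ [N MN] _ _] := tameT.
  apply: (seminorm_neq0 tameT adP _ _ _ Pk kx MN) => //.
  - exact: Skew_0.
  - by move=> *; exact: Skew_lin.
  - move=> t /(finite_M0 normalG bijT finG MN) ->; rewrite act_one.
    by move/esym.
have TE := space_group_T normalG bijT spaceG.
have tameT : tame x0 T C.
  by rewrite TE; apply: (tame_trans spaceG) => N; rewrite -TE; exact: repC.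
have [N MN kN] := sparse_translates spaceG kx.
rewrite -TE in MN kN.
(* Only linearity and skewness of the rotations enter, so one argument covers both seminorms. *)
have bnd Sk : Sk 0 -> (forall a A B, Sk A -> Sk B -> Sk (a *: A + B)) -> Sk `<=` Skew ->
    bounded_wrt (Uper T) (seminorm x0 T C P Sk) E2 /\
    stability_constant T C V P Sk \is a fin_num.
  move=> Sk0 SkL SkS.
  have b := energy2_bounded tameT adP Sk0 SkL SkS (space_spin_msdom spaceG adP) fA V_A V_orth (V_C2 _).
  by split=> //; apply: (stability_fin_num b); exact: (seminorm_neq0 tameT adP Sk0 SkL SkS Pk kx MN kN).
have [b f] := bnd _ (@Skew_0 R _) (fun a B B' => @Skew_lin R _ a B B') (fun _ h => h).
have [b00 f00] := bnd _ (@Skew00_0 R d1 d2) (fun a B B' => @Skew00_lin R d1 d2 a B B') Skew00S.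
exact: And4 b b00 f f00.
Qed.
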